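(* Let $\mathcal{A}\in\mathfrak{UH}(k,n_0)$ multiply two integers $A,B$, each represented with $n$ base-$s$ digits. (i) In the sequential model with a cache of $M$ words in which a single I/O operation moves up to $B\le M$ words stored in consecutive memory locations, every execution schedule of $\mathcal{A}$ performs $$\Omega\!\left(\left(\frac{n}{\max\{n_0,M\}}\right)^{\log_k(2k-1)}\left(\max\left\{1,\frac{n_0}{M}\right\}\right)^2\frac{M}{B}\right)$$ I/O operations. (ii) In the parallel model with $P$ processors, each with local memory of size $M<n^2$, and messages of up to $B_m\le M$ words, in every execution some processor sends or receives $$\Omega\!\left(\left(\frac{n}{\max\{n_0,M\}}\right)^{\log_k(2k-1)}\left(\max\left\{1,\frac{n_0}{M}\right\}\right)^2\frac{M}{PB_m}\right)$$ messages.
   Context: Integers are written in base $s\ge2$, one digit per memory word; $A=(A[n-1],\dots,A[0])_s$; the size of an integer is its number of digits. Computations are viewed as computational DAGs (vertices: input digits or results of unit-time operations; edges: data dependencies). Standard class: an algorithm multiplying $m$-digit integers $A,B$ is standard if it directly computes all $m^2$ elementary products $A[i]B[j]$; each digit $C[i]$ of $C=AB$ is computed by summing the products $A[j]B[k]$ with $j+k=i$ through a summation tree of additions and subtractions only, plus any carry; and the internal vertex sets of the summation trees of distinct $C[i]$ are disjoint. Toom-$k$ step ($k\ge 2$ integer) on $m$-digit $A,B$: split each into $k$ blocks of $\lceil m/k\rceil$ consecutive digits, use them as coefficients of polynomials $p,q$ of degree $k-1$ with $p(s^{\lceil m/k\rceil})=A$, $q(s^{\lceil m/k\rceil})=B$,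 evaluate $p,q$ at $2k-1$ distinct points, recursively compute the $2k-1$ products of the evaluations (sub-problems), interpolate the coefficients of $r=pq$ via the inverse Vandermonde matrix, and recompose $C=\sum_i r_is^{i\lceil m/k\rceil}$. Class $\mathfrak{UH}(k,n_0)$ (uniform, non-stationary hybrid algorithms): the same Toom-$k$ scheme is applied recursively to all (sub)problems in the first recursion levels, and every generated sub-problem of size at most $n_0$ is computed with an algorithm from the standard class; sub-problems of the same size are treated uniformly. Sequential model: cache of $M$ words and unbounded slow memory; operations only on values in cache; input initially in slow memory; read/write I/O operations move data between levels; recomputation allowed. Parallel model: $P$ processors with local (non-shared) memories exchanging point-to-point messages; recomputation allowed.
   Formalization: Assumes 1 ≤ n_0 ≤ n (the bound fails as n_0 grows past n); in (ii) each input digit initially lies in exactly one local memory and no processor holds more than n of the 2n digits (so P ≥ 2), since otherwise one processor could run everything without messages. *)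

(* Defs.v *)
From HB Require Import structures.
From mathcomp Require Import all_boot all_order all_algebra.
From mathcomp Require Import reals exp.

Set Implicit Arguments.
Unset Strict Implicit.
Unset Printing Implicit Defensive.

Import Order.TTheory GRing.Theory Num.Theory.
Local Open Scope ring_scope.

(** * Integers in base s *)

(* Position 0 is the least significant digit. *)
Definition value (s m : nat) (d : 'I_m -> int) : int :=
  \sum_(i < m) d i * (s%:Z) ^+ i.

(* One word holds one digit and its sign: the evaluation of a polynomial at a
   point may be negative, and a negative integer is represented by the digits
   of its absolute value, each carrying the sign. The representation with m
   digits of an integer, when it exists, is therefore unique. *)
Definition digits (s m : nat) (d : 'I_m -> int) : Prop :=
  (forall i, 0 <= d i < s%:Z) \/ (forall i, 0 <= - d i < s%:Z).

Definition represents (s m : nat) (d : 'I_m -> int) (z : int) : Prop :=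
  digits s d /\ value s d = z.

Definition ceil_div (m k : nat) : nat := ((m + k.-1) %/ k)%N.

(* The polynomial of degree < k whose coefficients are the k blocks of
   ceil (m / k) consecutive digits (the last blocks may be incomplete). *)
Definition block_poly (s k m : nat) (d : 'I_m -> int) : {poly int} :=
  let b := ceil_div m k in
  \poly_(j < k) \sum_(i < m | (i %/ b == j)%N) d i * (s%:Z) ^+ (i %% b)%N.

(** * Computational DAGs *)

(* A DAG for the multiplication of two n-digit integers. [preds v] lists the
   operands of the operation producing v, and [op v] is that operation; both
   are irrelevant when v is an input. *)
Record cdag (n : nat) := CDAG {
  vertex :> finType;
  preds : vertex -> seq vertex;
  op : vertex -> seq int -> int;
  inA : 'I_n -> vertex;
  inB : 'I_n -> vertex;
  outC : 'I_(2 * n) -> vertex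
}.

Definition inputs (n : nat) (G : cdag n) : {set G} :=
  [set v in codom (@inA n G)] :|: [set v in codom (@inB n G)].

(* The values taken by the vertices on some pair of n-digit inputs. *)
Definition run (s n : nat) (G : cdag n) (val : G -> int) : Prop :=
  (forall v, v \in inputs G -> 0 <= val v < s%:Z) /\
  (forall v, v \notin inputs G -> val v = op v (map val (preds v))).

Record well_formed (s n : nat) (G : cdag n) : Prop := WellFormed {
  wf_inA : injective (@inA n G);
  wf_inB : injective (@inB n G);
  wf_inAB : forall i j, inA G i != inB G j;
  wf_inputs : forall v, v \in inputs G -> preds v = [::];
  wf_acyclic : exists rank : G -> nat,
    forall v u : G, u \in preds v -> (rank u < rank v)%N;
  wf_word : forall val, run s val -> forall v : G, `|val v| < s%:Z
}.

Definition depends_on (n : nat) (G : cdag n) (X Y : {set G}) : Prop :=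
  forall v : G, v \in X -> {subset preds v <= X :|: Y}.

(** * Standard algorithms *)

Inductive sumtree (V : Type) : Type :=
| Leaf of V
| Node of V & sumtree V & sumtree V.

Definition root_of (V : Type) (t : sumtree V) : V :=
  match t with Leaf v => v | Node v _ _ => v end.

Fixpoint leaves (V : Type) (t : sumtree V) : seq V :=
  match t with Leaf v => [:: v] | Node _ l r => leaves l ++ leaves r end.

Fixpoint internals (V : Type) (t : sumtree V) : seq V :=
  match t with Leaf _ => [::] | Node v l r => v :: internals l ++ internals r end.

(* Since a word holds one digit, an operation on digits delivers its result
   modulo s; the excess is a carry, held by vertices of its own. *)
Fixpoint summation (s n : nat) (G : cdag n) (t : sumtree G) : Prop :=
  match t with
  | Leaf _ => True
  | Node v l r =>
    [/\ preds v = [:: root_of l; root_of r],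
        (forall val, run s val ->
           (val v = val (root_of l) + val (root_of r) %[mod s%:Z])%Z) \/
        (forall val, run s val ->
           (val v = val (root_of l) - val (root_of r) %[mod s%:Z])%Z),
        summation s l
      & summation s r]
  end.

(* The vertices U compute the 2m digits c of the product from the m-digit
   operands a and b. [prod i j] is the elementary product of a_i and b_j, [T i]
   the summation tree of c_i, and [carry i] the list of the carries added in
   position i; K i is the set of the vertices involved in the computation of
   these carries (such as the high digit of an elementary product, or the
   overflow of an addition), all of which depend on positions below i only. *)
Definition standard (s n : nat) (G : cdag n) (m : nat)
    (a b : 'I_m -> G) (c : 'I_(2 * m) -> G) (U : {set G}) : Prop :=
  exists (prod : 'I_m -> 'I_m -> G) (T : 'I_(2 * m) -> sumtree G)
         (carry : 'I_(2 * m) -> seq G) (K : 'I_(2 * m) -> {set G}),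
  (forall i j, preds (prod i j) = [:: a i; b j] /\
     forall val, run s val ->
       (val (prod i j) = val (a i) * val (b j) %[mod s%:Z])%Z) /\
  injective (fun ij : 'I_m * 'I_m => prod ij.1 ij.2) /\
  (forall i, root_of (T i) = c i /\ summation s (T i)) /\
  (forall i, perm_eq (leaves (T i))
     ([seq prod jl.1 jl.2 | jl : 'I_m * 'I_m <- enum {: 'I_m * 'I_m}
                          & ((jl.1 : nat) + jl.2 == i)%N] ++ carry i)) /\
  (forall i, uniq (internals (T i))) /\
  (forall i i' v, v \in internals (T i) -> v \in internals (T i') -> i = i') /\
  (forall i, uniq (carry i) /\ {subset carry i <= K i}) /\
  (forall i v u, v \in K i -> u \in preds v ->
     [\/ exists2 j : 'I_m, (j < i)%N & u = a j \/ u = b j,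
         exists2 j : 'I_(2 * m), (j < i)%N & u \in leaves (T j) ++ internals (T j)
       | exists2 j : 'I_(2 * m), (j <= i)%N & u \in K j]) /\
  U = [set v in codom (fun ij : 'I_m * 'I_m => prod ij.1 ij.2)]
        :|: \bigcup_(i < 2 * m) [set v in internals (T i)]
        :|: \bigcup_(i < 2 * m) K i /\
  (forall val, run s val ->
     represents s (val \o c) (value s (val \o a) * value s (val \o b))).

(** * Toom-k *)

Definition npoints (k : nat) : nat := (2 * k).-1.

(* Number of digits that suffice, besides those of a block, for the value at x
   of a polynomial with k coefficients: s ^ excess >= \sum_j |x| ^ j. *)
Definition excess (s k : nat) (x : int) : nat :=
  up_log s (\sum_(j < k) `|x|%N ^ j)%N.

Definition eval_matrix (k : nat) (x : 'I_(npoints k) -> int) :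
    'M[rat]_(npoints k) :=
  \matrix_(i, l) (x i)%:~R ^+ l.

(* The vertices U reduce the product c of the m-digit operands a and b to the
   2k-1 sub-problems (subA i, subB i, subC i), of sizes sz i, themselves
   computed by the vertices subU i. *)
Record toom_step (s k n : nat) (x : 'I_(npoints k) -> int)
    (sz : 'I_(npoints k) -> nat) (G : cdag n) (m : nat)
    (a b : 'I_m -> G) (c : 'I_(2 * m) -> G) (U : {set G}) := ToomStep {
  subA : forall i, 'I_(sz i) -> G;
  subB : forall i, 'I_(sz i) -> G;
  subC : forall i, 'I_(2 * sz i) -> G;
  subU : 'I_(npoints k) -> {set G};
  evalA : {set G};
  evalB : {set G};
  interpolation : {set G};
  recomposition : {set G};
  (* the coefficients of r, each on [width] digits *)
  width : nat;
  coef : 'I_(npoints k) -> 'I_width -> G;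

  toom_disjoint : pairwise (fun X Y : {set G} => [disjoint X & Y])
    ([:: evalA; evalB; interpolation; recomposition]
       ++ [seq subU i | i : 'I_(npoints k)]);
  toom_cover : U = evalA :|: evalB :|: (\bigcup_i subU i)
    :|: interpolation :|: recomposition;

  toom_evalA_dep : depends_on evalA [set v in codom a];
  toom_evalB_dep : depends_on evalB [set v in codom b];
  toom_subA_in : forall i t, @subA i t \in evalA :|: [set v in codom a];
  toom_subB_in : forall i t, @subB i t \in evalB :|: [set v in codom b];
  toom_subA_inj : forall i, injective (@subA i);
  toom_subB_inj : forall i, injective (@subB i);
  toom_evalA : forall val, run s val -> forall i,
    represents s (val \o @subA i) (block_poly s k (val \o a)).[x i];
  toom_evalB : forall val, run s val -> forall i,
    represents s (val \o @subB i) (block_poly s k (val \o b)).[x i];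

  toom_interp_dep :
    depends_on interpolation (\bigcup_i [set v in codom (@subC i)]);
  toom_coef_in : forall l t,
    coef l t \in interpolation :|: \bigcup_i [set v in codom (@subC i)];
  toom_interp : forall val, run s val -> forall l,
    digits s (val \o coef l) /\
    (value s (val \o coef l))%:~R =
      (invmx (eval_matrix x)
         *m \col_i (value s (val \o @subC i))%:~R : 'cV[rat]_(npoints k)) l 0;

  toom_recomp_dep :
    depends_on recomposition (\bigcup_l [set v in codom (coef l)]);
  toom_c_in : forall t,
    c t \in recomposition :|: \bigcup_l [set v in codom (coef l)];
  toom_recomp : forall val, run s val ->
    represents s (val \o c)
      (\sum_l value s (val \o coef l) * (s%:Z) ^+ (l * ceil_div m k)%N)
}.

Arguments subA {s k n x sz G m a b c U} t i _ : rename.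
Arguments subB {s k n x sz G m a b c U} t i _ : rename.
Arguments subC {s k n x sz G m a b c U} t i _ : rename.

(** * Uniform hybrid algorithms *)

(* How a (sub-)problem is solved depends on its size only: [sz m i] is the size
   of the i-th sub-problem of a problem of size m. *)
Inductive hybrid (s k : nat) (x : 'I_(npoints k) -> int) (n0 : nat)
    (sz : nat -> 'I_(npoints k) -> nat) (n : nat) (G : cdag n) :
    forall m, ('I_m -> G) -> ('I_m -> G) -> ('I_(2 * m) -> G) ->
      {set G} -> Prop :=
| hybrid_standard m (a b : 'I_m -> G) (c : 'I_(2 * m) -> G) (U : {set G}) :
    (m <= n0)%N -> standard s a b c U -> hybrid s x n0 sz a b c U
| hybrid_toom m (a b : 'I_m -> G) (c : 'I_(2 * m) -> G) (U : {set G})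
    (t : toom_step s x (sz m) a b c U) :
    (n0 < m)%N ->
    (forall i, hybrid s x n0 sz (subA t i) (subB t i) (subC t i) (subU t i)) ->
    hybrid s x n0 sz a b c U.
Arguments hybrid s k x n0 sz {n} G {m} a b c U.

(* The members of the class UH(k, n0) multiplying n-digit integers in base s,
   x being the evaluation points of the Toom-k scheme. *)
Definition UH (s k : nat) (x : 'I_(npoints k) -> int) (n0 n : nat)
    (G : cdag n) : Prop :=
  well_formed s G /\
  exists2 sz : nat -> 'I_(npoints k) -> nat,
    forall m i, (ceil_div m k <= sz m i <= ceil_div m k + excess s k (x i))%N
    & hybrid s k x n0 sz G (@inA n G) (@inB n G) (@outC n G) (~: inputs G).
Arguments UH s k x n0 {n} G.

(** * Executions *)

(* [seq_exec M B C mem D q]: some sequence of operations with q I/Os, each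
   moving at most B words, leads to a cache holding (the values of) the
   vertices in C and a slow memory with contents [mem], and has computed each
   vertex of D at least once. Any operation may discard words from the cache;
   a vertex may be computed any number of times. *)
Inductive seq_exec (n : nat) (G : cdag n) (M B : nat) :
    {set G} -> (nat -> option G) -> {set G} -> nat -> Prop :=
| seq_start (mem : nat -> option G) :
    (forall addr v, mem addr = Some v -> v \in inputs G) ->
    (forall v, v \in inputs G -> exists addr, mem addr = Some v) ->
    seq_exec M B set0 mem set0 0
| seq_compute C mem D q (v : G) (C' : {set G}) :
    seq_exec M B C mem D q ->
    v \notin inputs G -> {subset preds v <= C} ->
    v \in C' -> C' \subset v |: C -> (#|C'| <= M)%N ->
    seq_exec M B C' mem (v |: D) q
| seq_read C mem D q (addr len : nat) (C' : {set G}) :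
    seq_exec M B C mem D q -> (len <= B)%N ->
    C' \subset C :|: [set v | [exists i : 'I_len, mem (addr + i)%N == Some v]] ->
    (#|C'| <= M)%N ->
    seq_exec M B C' mem D q.+1
| seq_write C mem D q (addr : nat) (w : seq G) :
    seq_exec M B C mem D q -> (size w <= B)%N -> {subset w <= C} ->
    seq_exec M B C
      (fun i => if (addr <= i < addr + size w)%N
                then nth None (map Some w) (i - addr)%N else mem i)
      D q.+1.

(* Initially, each of the 2n input digits resides in exactly one local memory,
   and no processor holds more than half of them: a processor holding all of
   them could run the whole algorithm without any communication. *)
Definition distributed (n : nat) (G : cdag n) (P M : nat)
    (L : 'I_P -> {set G}) : Prop :=
  [/\ forall p, L p \subset inputs G,
      forall v, v \in inputs G -> exists! p, v \in L p
    & forall p, (#|L p| <= M)%N /\ (#|L p| <= n)%N].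

(* [L p] is the contents of the local memory of p, D the set of the vertices
   computed so far by some processor, and [q p] the number of messages sent or
   received so far by p. *)
Inductive par_exec (n : nat) (G : cdag n) (P M Bm : nat) :
    ('I_P -> {set G}) -> {set G} -> ('I_P -> nat) -> Prop :=
| par_start (L : 'I_P -> {set G}) :
    distributed M L -> par_exec M Bm L set0 (fun=> 0%N)
| par_compute L D q (p : 'I_P) (v : G) (S : {set G}) :
    par_exec M Bm L D q ->
    v \notin inputs G -> {subset preds v <= L p} ->
    v \in S -> S \subset v |: L p -> (#|S| <= M)%N ->
    par_exec M Bm (fun i => if i == p then S else L i) (v |: D) q
| par_message L D q (p p' : 'I_P) (W S : {set G}) :
    par_exec M Bm L D q -> p != p' ->
    W \subset L p -> (#|W| <= Bm)%N ->
    S \subset L p' :|: W -> (#|S| <= M)%N ->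
    par_exec M Bm (fun i => if i == p' then S else L i) D
      (fun i => q i + (i == p) + (i == p'))%N.

(* An execution of the whole algorithm performs every operation at least
   once. *)
Definition complete (n : nat) (G : cdag n) (D : {set G}) : Prop :=
  ~: inputs G \subset D.

(** * The bound *)

Definition logb (R : realType) (k y : nat) : R := ln y%:R / ln k%:R.

Definition hybrid_bound (R : realType) (k n n0 M : nat) : R :=
  (n%:R / (maxn n0 M)%:R) `^ logb R k (2 * k - 1)%N
    * (Num.max 1 (n0%:R / M%:R)) ^+ 2.

(* Main.v *)
(* If only the low mu digits of A and B are nonzero, where mu = n / k ^ l, then
   all the sub-problems of level l have A and B themselves as operands. Fixing
   B = s ^ j, the output digits of a sub-problem are then freely varying digits
   of A. A segment of an execution in which a processor moves O(M) words knows
   O(M) words, hence, if mu is a large multiple of M, has too little information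
   about the operands: it can compute only as many output digits of a sub-problem
   as it knows words interior to this sub-problem, up to a constant factor. The
   interiors are pairwise disjoint, so at level l, with mu of the order of M, at
   least (2k-1) ^ l * M words, up to a constant factor, have to be moved. This
   holds even though the operands may be shared, and although values may be
   recomputed.

   When M is much smaller than n0, consider the standard algorithms at the
   leaves: a segment knows O(M) digits of an operand, hence computes O(M) of the
   t + 1 products summed in the digit t. The summation tree of that digit must
   therefore contain about t / M vertices kept at the end of a segment. When M is
   at least of the order of n, the bound is that of a single segment for each
   processor, applied to the whole product; a processor starts with at most half
   of the input digits, hence ignores half of those of A or half of those of B. *)
Require Import Defs.
From mathcomp Require Import all_boot all_order all_algebra.
From mathcomp Require Import reals exp.
From mathcomp Require Import zify ring.
Import Order.TTheory GRing.Theory Num.Theory.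
Local Open Scope ring_scope.

Set Implicit Arguments.
Unset Strict Implicit.
Unset Printing Implicit Defensive.

(** * Digits and runs *)

Lemma value_inj (s m : nat) (d e : 'I_m -> int) :
  (forall i, 0 <= d i < s%:Z) -> (forall i, 0 <= e i < s%:Z) ->
  value s d = value s e -> d =1 e.
Proof.
rewrite /value; elim: m d e => [|m IHm] d e hd he; first by move=> _ [].
rewrite !big_ord_recl !expr0 !mulr1.
have shift (f : 'I_m.+1 -> int) : \sum_(i < m) f (lift ord0 i) * s%:Z ^+ lift ord0 i
    = (\sum_(i < m) f (lift ord0 i) * s%:Z ^+ i) * s%:Z.
  by rewrite mulr_suml; apply: eq_bigr => i _; rewrite exprSr mulrA.
rewrite !shift => eq_de.
have s_neq0 : s%:Z != 0 by have := hd ord0; lia.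
have eq0 : d ord0 = e ord0.
  have := congr1 (fun z => (z %% s%:Z)%Z) eq_de.
  by rewrite !(addrC (_ ord0)) !modzMDl !modz_small ?hd ?he.
move: eq_de; rewrite eq0 => /addrI /(mulIf s_neq0) /IHm eqS i.
case: (unliftP ord0 i) => [j|] ->; last exact: eq0.
by apply: eqS => l; [apply: hd | apply: he].
Qed.

(** The sign shared by the digits is not known beforehand. If they are nonpositive, the value is
    both at most and at least 0, and uniqueness makes both families of digits vanish. *)
Lemma represents_digits (s m : nat) (d : 'I_m -> int) (alpha : 'I_m -> int) :
  (forall i, 0 <= alpha i < s%:Z) -> represents s d (value s alpha) ->
  d =1 alpha.
Proof.
move=> halpha [[hd|hd] eqv]; first exact: value_inj eqv.
case: m => [|m] in d alpha halpha hd eqv *; first by case.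
have s_gt0 : 0 < s%:Z by have := hd ord0; lia.
have le0 (f : 'I_m.+1 -> int) : (forall i, 0 <= f i < s%:Z) -> 0 <= value s f.
  move=> hf; apply: sumr_ge0 => i _.
  by rewrite mulr_ge0 ?exprn_ge0 ?(ltW s_gt0) //; case/andP: (hf i).
have valueN : value s (fun i => - d i) = - value s d.
  by rewrite /value -sumrN; apply: eq_bigr => i _; rewrite mulNr.
have value0 : value s (fun=> 0 : int) = 0 :> int.
  by move=> l; rewrite /value big1 // => i _; rewrite mul0r.
have h0 (i : 'I_m.+1) : 0 <= (0 : int) < s%:Z by rewrite lexx.
have alpha0 : value s alpha = 0.
  by apply: le_anti; rewrite le0 // andbT -eqv -oppr_ge0 -valueN le0.
move=> i; have /(_ i) := value_inj halpha h0 (etrans alpha0 (esym (value0 _))) => ->.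
have dz : value s (fun i => - d i) = 0 by rewrite valueN eqv alpha0 oppr0.
have /(_ i) := value_inj hd h0 (etrans dz (esym (value0 _))).
by move/eqP; rewrite oppr_eq0 => /eqP.
Qed.

Lemma value_widen (s m mu : nat) (alpha : nat -> int) :
  (mu <= m)%N -> (forall i, (mu <= i)%N -> alpha i = 0) ->
  value s (fun i : 'I_m => alpha i) = \sum_(i < mu) alpha i * s%:Z ^+ i.
Proof.
move=> le_mu alpha0; rewrite [RHS](big_ord_widen m (fun i => alpha i * s%:Z ^+ i)) //.
rewrite [RHS]big_mkcond; apply: eq_bigr => i _.
by case: ltnP => // /alpha0 ->; rewrite mul0r.
Qed.

Section Runs.
Variables (s n : nat) (G : cdag n).
Hypothesis wfG : well_formed s G.

(** All vertices are updated simultaneously, again and again; the value of a vertex no longer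
    changes once the number of rounds exceeds its rank. *)
Lemma run_exists (alpha beta : nat -> int) :
  (forall i, 0 <= alpha i < s%:Z) -> (forall i, 0 <= beta i < s%:Z) ->
  exists val : G -> int, [/\ run s val,
    forall i : 'I_n, val (inA G i) = alpha i
  & forall i : 'I_n, val (inB G i) = beta i].
Proof.
move=> ha hb; have [injA injB disj inp0 [rank rankP] _] := wfG.
pose init (v : G) : int :=
  if [pick i | inA G i == v] is Some i then alpha i
  else if [pick i | inB G i == v] is Some i then beta i else 0.
pose step (f : G -> int) (v : G) :=
  if v \in inputs G then init v else op v (map f (preds v)).
pose F j := iter j step init.
have stable j v : (rank v < j)%N -> F j.+1 v = F j v.
  elim: j v => // j IHj v lt_v; rewrite /F (iterS j.+1) (iterS j) /step.
  case: ifP => // _; congr (op v _); apply/eq_in_map => u /rankP lt_u.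
  exact/IHj/(leq_trans lt_u).
(* [N] exceeds every rank, so one more round changes nothing and [F N] satisfies the equations of a
   run. *)
pose N := (\max_(v : G) rank v).+1.
have valE v : F N v = step (F N) v.
  by rewrite -[RHS]/(F N.+1 v) stable // ltnS; apply: leq_bigmax.
have initA i : init (inA G i) = alpha i.
  rewrite /init; case: pickP => [j /eqP/injA -> //|/(_ i)]; by rewrite eqxx.
have initB i : init (inB G i) = beta i.
  rewrite /init; case: pickP => [j|_]; first by rewrite (negPf (disj _ _)).
  case: pickP => [j /eqP/injB -> //|/(_ i)]; by rewrite eqxx.
have inAI i : inA G i \in inputs G by rewrite !inE codom_f.
have inBI i : inB G i \in inputs G by rewrite !inE codom_f orbT.
exists (F N); split=> [|i|i]; last 2 first.
- by rewrite valE /step inAI initA.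
- by rewrite valE /step inBI initB.
split=> v v_in; rewrite valE /step.
  rewrite v_in; move: v_in; rewrite !inE.
  by case/orP=> /codomP[i ->]; rewrite ?initA ?initB.
by rewrite (negPf v_in); apply/congr1/eq_map.
Qed.

(** [K] is what is known, [E] what is computed from it, and [W] is closed under operands. By
    induction on the rank, nothing computed in [W] can tell apart two runs that agree on the known
    words of [W]. *)
Lemma agree_closed (val val' : G -> int) (K E W : {set G}) :
  run s val -> run s val' ->
  (forall v, v \in E -> v \notin inputs G /\ {subset preds v <= K :|: E}) ->
  (forall v, v \in W -> {subset preds v <= W}) ->
  {in K :&: W, val =1 val'} -> {in (K :|: E) :&: W, val =1 val'}.
Proof.
move=> [_ hr] [_ hr'] hE hW agK; have [_ _ _ _ [rank rankP] _] := wfG.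
move=> v; have [j] := ubnP (rank v); elim: j v => // j IHj v lt_v.
rewrite !inE => /andP[/orP[vK|vE] vW]; first by apply: agK; rewrite inE vK.
have [vI sub] := hE v vE; rewrite hr ?hr' //; congr (op v _).
apply/eq_in_map => u u_v; apply: IHj; first exact: leq_trans (rankP _ _ u_v) _.
by rewrite inE sub // (hW v vW u u_v).
Qed.

(** This is [agree_closed] with the inputs in [X] as the known words and the rest of [X] computed
    from them. *)
Lemma agree_side (val val' : G -> int) (X : {set G}) :
  run s val -> run s val' -> (forall v, v \in X -> {subset preds v <= X}) ->
  {in X :&: inputs G, val =1 val'} -> {in X, val =1 val'}.
Proof.
move=> hr hr' hX ag v vX.
apply: (@agree_closed val val' (X :&: inputs G) (X :\: inputs G) X) => //.
- move=> u; rewrite inE => /andP[uI uX]; split=> // t /(hX _ uX) tX.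
  by rewrite !inE tX; case: (_ \in codom _); case: (_ \in codom _).
- by move=> u; rewrite inE => /andP[/ag].
by rewrite !inE vX; case: (_ \in codom _); case: (_ \in codom _).
Qed.

End Runs.

(** * Correctness of the Toom-k recursion *)

Lemma ceil_divP (m k : nat) : (0 < k)%N ->
  (m <= k * ceil_div m k)%N /\ (k * ceil_div m k < m + k)%N.
Proof. by move=> k_gt0; rewrite /ceil_div; nia. Qed.

Lemma ceil_div_le (m k : nat) : (1 < k)%N -> (ceil_div m k <= m)%N.
Proof.
move=> k_gt1; case: (posnP m) => [->|m_gt0]; last by rewrite /ceil_div; nia.
by rewrite /ceil_div add0n divn_small //; lia.
Qed.

Lemma leq_ceil_div (m m' k : nat) : (m <= m')%N -> (ceil_div m k <= ceil_div m' k)%N.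
Proof. by move=> le_m; rewrite leq_div2r // leq_add2r. Qed.

Lemma horner_block_poly (s k m : nat) (d : 'I_m -> int) : (0 < k)%N ->
  (block_poly s k d).[s%:Z ^+ ceil_div m k] = value s d.
Proof.
move=> k_gt0; rewrite horner_poly /value; set b := ceil_div m k.
have [le_m _] := ceil_divP m k_gt0; rewrite -/b in le_m.
have lt_k (i : 'I_m) : (i %/ b < k)%N.
  have b_gt0 : (0 < b)%N by have := ltn_ord i; case: b le_m => //; lia.
  by rewrite ltn_divLR //; apply: leq_trans le_m.
under eq_bigr => j _ do rewrite mulr_suml big_mkcond.
rewrite exchange_big; apply: eq_bigr => i _.
rewrite (bigD1 (Ordinal (lt_k i))) //= eqxx big1 ?addr0 => [|j]; last first.
  by rewrite -val_eqE /= eq_sym => /negPf ->.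
by rewrite -exprM -mulrA -exprD addnC mulnC -divn_eq.
Qed.

(** The nonzero digits all fit in the first block, so the polynomial is constant and its value at
    any point is the operand itself. This is what makes all the sub-problems of a level receive the
    same operands. *)
Lemma block_poly_low (s k m mu : nat) (alpha : nat -> int) :
  (0 < k)%N -> (ceil_div mu k <= mu <= m)%N ->
  (forall i, (ceil_div mu k <= i)%N -> alpha i = 0) ->
  block_poly s k (fun i : 'I_m => alpha i)
    = (value s (fun i : 'I_(ceil_div mu k) => alpha i))%:P.
Proof.
move=> k_gt0 /andP[le_mu' le_mu] alpha0; apply/polyP => j; rewrite coef_poly coefC.
have le_b : (ceil_div mu k <= ceil_div m k)%N by exact: leq_ceil_div.
case: ltnP => [lt_jk|le_kj]; last by case: eqP le_kj => // ->; rewrite leqNgt k_gt0.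
case: eqP => [->|/eqP j_neq0].
  rewrite (value_widen s (leqnn _) alpha0) -(value_widen s (leq_trans le_mu' le_mu) alpha0).
  rewrite /value [LHS]big_mkcond; apply: eq_bigr => i _.
  case: (ltnP i (ceil_div m k)) => [lt_i|le_i]; first by rewrite divn_small // eqxx modn_small.
  by rewrite alpha0 ?mul0r ?if_same // (leq_trans le_b).
rewrite big1 // => i /eqP def_j; rewrite alpha0 ?mul0r //; apply: leq_trans le_b _.
by rewrite leqNgt; apply: contraNN j_neq0 => lt_i; rewrite -def_j divn_small.
Qed.

Section Toom.
Variables (s k : nat) (x : 'I_(npoints k) -> int).
Hypotheses (k_gt1 : (1 < k)%N) (inj_x : injective x).

Lemma eval_matrix_unit : eval_matrix x \in unitmx.
Proof.
pose a : 'rV[rat]_(npoints k) := \row_i (x i)%:~R.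
have -> : eval_matrix x = (Vandermonde (npoints k) a)^T.
  by apply/matrixP => i j; rewrite !mxE.
rewrite unitmx_tr unitmxE det_Vandermonde unitfE.
apply/prodf_neq0 => i _; apply/prodf_neq0 => j lt_ij.
rewrite !mxE subr_eq0; apply: contraTneq lt_ij => /intr_inj/inj_x ->.
by rewrite ltnn.
Qed.

(** The product of the two block polynomials has fewer than [2k] coefficients, so its values at
    [2k-1] distinct points determine it; its value at the power of [s] given by the block length is
    the product of the operands. *)
Lemma toom_correct (n : nat) (G : cdag n) (m : nat) (sz : 'I_(npoints k) -> nat)
    (a b : 'I_m -> G) (c : 'I_(2 * m) -> G) (U : {set G})
    (t : toom_step s x sz a b c U) (val : G -> int) :
  run s val ->
  (forall i, represents s (val \o subC t i)
     (value s (val \o subA t i) * value s (val \o subB t i))) ->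
  represents s (val \o c) (value s (val \o a) * value s (val \o b)).
Proof.
move=> hrun hsub; have := toom_recomp t hrun; congr represents.
set p := block_poly s k (val \o a); set q := block_poly s k (val \o b).
have k_gt0 : (0 < k)%N by lia.
have size_pq : (size (p * q)%R <= npoints k)%N.
  have := size_polyMleq p q.
  have : (size p <= k)%N by exact: size_poly.
  have : (size q <= k)%N by exact: size_poly.
  by rewrite /npoints; lia.
have coefE l : value s (val \o coef (t0 := t) l) = (p * q)%R`_l.
  apply: (@intr_inj rat); have [_ ->] := toom_interp t hrun l.
  have -> : \col_i (value s (val \o subC t i))%:~R
      = eval_matrix x *m \col_i ((p * q)%R`_i)%:~R :> 'cV[rat]_(npoints k).
    apply/colP => i; rewrite !mxE.
    have [_ ->] := hsub i.
    have [_ ->] := toom_evalA t hrun i; have [_ ->] := toom_evalB t hrun i.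
    rewrite -hornerM (horner_coef_wide _ size_pq) rmorph_sum; apply: eq_bigr => j _.
    by rewrite !mxE rmorphM rmorphXn mulrC.
  by rewrite mulmxA mulVmx ?eval_matrix_unit // mul1mx mxE.
under eq_bigr => l _ do rewrite coefE mulnC exprM.
by rewrite -(horner_coef_wide _ size_pq) hornerM !horner_block_poly.
Qed.

End Toom.

Section Hybrid.
Variables (s k : nat) (x : 'I_(npoints k) -> int) (n0 : nat).
Variables (sz : nat -> 'I_(npoints k) -> nat) (n : nat) (G : cdag n).
Hypotheses (k_gt1 : (1 < k)%N) (inj_x : injective x).

Lemma hybrid_inv m (a b : 'I_m -> G) c (U : {set G}) :
  hybrid s k x n0 sz G a b c U ->
  ((m <= n0)%N /\ standard s a b c U) \/
  ((n0 < m)%N /\ exists t : toom_step s x (sz m) a b c U, forall i,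
     hybrid s k x n0 sz G (subA t i) (subB t i) (subC t i) (subU t i)).
Proof.
case=> {m a b c U} m a b c U; first by left.
by move=> t lt_m ht; right; split=> //; exists t.
Qed.

Lemma sumtree_root (T : eqType) (t : sumtree T) :
  root_of t \in leaves t ++ internals t.
Proof. by case: t => [v|v l r]; rewrite ?mem_cat /= ?mem_head ?inE ?eqxx ?orbT. Qed.

Lemma summation_preds (t : sumtree G) v : summation s t -> v \in internals t ->
  {subset preds v <= leaves t ++ internals t}.
Proof.
elim: t => [//|u l IHl r IHr] /= [predsE _ hl hr].
have sub_l : {subset leaves l ++ internals l
    <= (leaves l ++ leaves r) ++ u :: internals l ++ internals r}.
  by move=> w; rewrite !(mem_cat, inE) => /orP[] ->; rewrite ?orbT.
have sub_r : {subset leaves r ++ internals r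
    <= (leaves l ++ leaves r) ++ u :: internals l ++ internals r}.
  by move=> w; rewrite !(mem_cat, inE) => /orP[] ->; rewrite ?orbT.
rewrite inE mem_cat => /or3P[/eqP ->|v_l|v_r] w.
- by rewrite predsE !inE => /orP[] /eqP ->; [apply: sub_l | apply: sub_r]; apply: sumtree_root.
- by move/(IHl hl v_l)/sub_l.
by move/(IHr hr v_r)/sub_r.
Qed.

(** The induction hypothesis common to standard algorithms and Toom steps: the interior of a
    sub-problem communicates with the rest through its operands only, and it yields the correct
    digits. *)
Definition sound m (a b : 'I_m -> G) (c : 'I_(2 * m) -> G) (U : {set G}) : Prop :=
  [/\ forall t, c t \in U,
      depends_on U ([set v in codom a] :|: [set v in codom b])
    & forall val, run s val ->
        represents s (val \o c) (value s (val \o a) * value s (val \o b))].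

Lemma standard_sound m (a b : 'I_m -> G) c (U : {set G}) :
  standard s a b c U -> sound a b c U.
Proof.
case=> prod [T [carry [K [h_prod [_ [h_T [h_leaves [_ [_ [h_carry [h_K [defU h_val]]]]]]]]]]]].
have inU_prod i j : prod i j \in U.
  by rewrite defU !inE (codom_f (fun ij => prod ij.1 ij.2) (i, j)).
have inU_int i v : v \in internals (T i) -> v \in U.
  move=> hv; rewrite defU !inE; apply/orP; left; apply/orP; right.
  by apply/bigcupP; exists i; rewrite ?inE.
have inU_K i v : v \in K i -> v \in U.
  by move=> hv; rewrite defU inE; apply/orP; right; apply/bigcupP; exists i.
have inU_T i v : v \in leaves (T i) ++ internals (T i) -> v \in U.
  rewrite mem_cat (perm_mem (h_leaves i)) mem_cat => /orP[/orP[/mapP[jl _ ->]|]|/inU_int //] //.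
  by case: (h_carry i) => _ sub /sub/inU_K.
split=> [t|v|//].
  by have [<- _] := h_T t; apply: (inU_T t); apply: sumtree_root.
rewrite {1}defU !inE -orbA => /or3P[/codomP[[i j] ->] /= u|/bigcupP[i _]|/bigcupP[i _ vK]].
- have [-> _] := h_prod i j; rewrite !inE.
  by case/orP=> /eqP ->; rewrite codom_f ?orbT.
- rewrite inE => v_i u; have [_ hs] := h_T i.
  by move/(summation_preds hs v_i)/inU_T; rewrite inE => ->.
move=> u /(h_K i v u vK)[[j _ [->|->]]|[j _ /inU_T uU]|[j _ /inU_K uU]].
- by rewrite !inE codom_f !orbT.
- by rewrite !inE codom_f !orbT.
- by rewrite inE uU.
by rewrite inE uU.
Qed.

Lemma toom_sound m (a b : 'I_m -> G) c (U : {set G})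
    (t : toom_step s x (sz m) a b c U) :
  (forall i, sound (subA t i) (subB t i) (subC t i) (subU t i)) ->
  sound a b c U.
Proof.
move=> IH; have /setP coverE := toom_cover t.
have subCU i j : subC t i j \in subU t i by have [->] := IH i.
have evA v : v \in evalA t -> v \in U by rewrite coverE !inE => ->.
have evB v : v \in evalB t -> v \in U by rewrite coverE !inE => ->; rewrite ?orbT.
have inter v : v \in interpolation t -> v \in U by rewrite coverE !inE => ->; rewrite ?orbT.
have recom v : v \in recomposition t -> v \in U by rewrite coverE !inE => ->; rewrite ?orbT.
have subUU i v : v \in subU t i -> v \in U.
  move=> hv; rewrite coverE !inE; do 2 (apply/orP; left); apply/orP; right.
  by apply/bigcupP; exists i.
have subCs v : v \in \bigcup_i [set w in codom (subC t i)] -> v \in U.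
  by case/bigcupP=> i _; rewrite inE => /codomP[j ->]; apply: subUU (subCU i j).
have coefU l j : coef (t0 := t) l j \in U.
  by have := toom_coef_in (t0 := t) l j; rewrite inE => /orP[/inter|/subCs].
have coefs v : v \in \bigcup_l [set w in codom (coef (t0 := t) l)] -> v \in U.
  by case/bigcupP=> l _; rewrite inE => /codomP[j ->].
have subAI i j : subA t i j \in U :|: [set v in codom a].
  by have := toom_subA_in t j; rewrite !inE => /orP[/evA|] ->; rewrite ?orbT.
have subBI i j : subB t i j \in U :|: [set v in codom b].
  by have := toom_subB_in t j; rewrite !inE => /orP[/evB|] ->; rewrite ?orbT.
split=> [j|v|val hrun].
- by have := toom_c_in t j; rewrite inE => /orP[/recom|/coefs].
- rewrite coverE !inE -!orbA => /or4P[vA|vB|/bigcupP[i _ vS]|/orP[vI|vR]] u hu.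
  + by have := toom_evalA_dep vA hu; rewrite !inE => /orP[/evA|] ->; rewrite ?orbT.
  + by have := toom_evalB_dep vB hu; rewrite !inE => /orP[/evB|] ->; rewrite ?orbT.
  + have [_ dep _] := IH i; have := dep v vS u hu.
    rewrite !inE => /or3P[/subUU ->//|/codomP[j ->]|/codomP[j ->]].
      by have := subAI i j; rewrite !inE => /orP[] ->; rewrite ?orbT.
    by have := subBI i j; rewrite !inE => /orP[] ->; rewrite ?orbT.
  + by have := toom_interp_dep vI hu; rewrite !inE => /orP[/inter|/subCs] ->.
  by have := toom_recomp_dep vR hu; rewrite !inE => /orP[/recom|/coefs] ->.
apply: (toom_correct k_gt1 inj_x (t := t)) => // i.
by have [_ _ /(_ val hrun)] := IH i.
Qed.

Lemma hybrid_sound m (a b : 'I_m -> G) c (U : {set G}) :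
  hybrid s k x n0 sz G a b c U -> sound a b c U.
Proof.
elim=> {m a b c U} m a b c U; first by move=> _ /standard_sound.
by move=> t _ _ IH; apply: toom_sound IH.
Qed.

End Hybrid.

(** * Sub-problems of a given level *)

Lemma eq_block_poly (s k m : nat) (d e : 'I_m -> int) :
  d =1 e -> block_poly s k d = block_poly s k e.
Proof.
by move=> eq_de; apply/polyP => j; rewrite !coef_poly; under eq_bigr do rewrite eq_de.
Qed.

(** [sideA] and [sideB] accumulate the evaluation steps of all the levels above. Sub-problems of the
    same level may share them, whereas their interiors [psteps] will be disjoint. *)
Record problem (n : nat) (G : cdag n) := Problem {
  psize : nat;
  opA : 'I_psize -> G;
  opB : 'I_psize -> G;
  prodC : 'I_(2 * psize) -> G;
  psteps : {set G};
  sideA : {set G};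
  sideB : {set G}
}.

Section Problems.
Variables (s k : nat) (x : 'I_(npoints k) -> int) (n0 : nat).
Variables (sz : nat -> 'I_(npoints k) -> nat) (n : nat) (G : cdag n).
Hypotheses (k_gt1 : (1 < k)%N) (inj_x : injective x).
Hypothesis wfG : well_formed s G.
Hypothesis sz_bound : forall m i,
  (ceil_div m k <= sz m i <= ceil_div m k + excess s k (x i))%N.

(* A bound e on the excess of the sizes over those of unpadded blocks, preserved
   by the recursion since ceil (e / k) + max excess <= e. *)
Definition slack : nat := ((\max_i excess s k (x i)).*2.+1)%N.

(* [inX] is one of the two families of input digits, [X] the set of the
   vertices leading from it to the operand [d]. *)
Record operand_of (inX : 'I_n -> G) (mu m : nat) (d : 'I_m -> G) (X : {set G}) :
    Prop := OperandOf {
  op_closed : forall v, v \in X -> {subset preds v <= X};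
  op_inputs : forall v, v \in X -> v \in inputs G -> v \in codom inX;
  op_in : forall i, d i \in X;
  op_val : forall (val : G -> int) (alpha : nat -> int), run s val ->
    (forall i, 0 <= alpha i < s%:Z) -> (forall i, (mu <= i)%N -> alpha i = 0) ->
    (forall i, val (inX i) = alpha i) -> forall i, val (d i) = alpha i
}.

(** The size [mu] is that of unpadded blocks: inputs with only [mu] low digits are passed on
    unchanged to the operands. The actual size may be larger because evaluation can lengthen the
    operands. *)
Record problem_at (mu : nat) (N : problem G) : Prop := ProblemAt {
  at_hybrid : hybrid s k x n0 sz G (@opA n G N) (@opB n G N) (@prodC n G N) (psteps N);
  at_size : (mu <= psize N <= mu + slack)%N;
  at_steps : psteps N \subset ~: inputs G;
  at_opA : operand_of (@inA n G) mu (@opA n G N) (sideA N);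
  at_opB : operand_of (@inB n G) mu (@opB n G N) (sideB N)
}.

Lemma operand_of_input (inX : 'I_n -> G) mu :
  (forall i, inX i \in inputs G) -> (mu <= n)%N ->
  operand_of inX mu inX [set v in codom inX].
Proof.
have [_ _ _ inp0 _ _] := wfG.
move=> inXI le_mu; split=> [v|v|i|val alpha _ _ _ //].
- by rewrite inE => /codomP[i ->]; rewrite inp0.
- by rewrite inE.
by rewrite inE codom_f.
Qed.

Lemma root_problem :
  hybrid s k x n0 sz G (@inA n G) (@inB n G) (@outC n G) (~: inputs G) ->
  problem_at n (Problem (@inA n G) (@inB n G) (@outC n G) (~: inputs G)
    [set v in codom (@inA n G)] [set v in codom (@inB n G)]).
Proof.
move=> hyb; split=> //=; first by rewrite leqnn leq_addr.
  by apply: operand_of_input => // i; rewrite !inE codom_f.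
by apply: operand_of_input => // i; rewrite !inE codom_f orbT.
Qed.

(** By [block_poly_low] the evaluation is the value of the operand, and the uniqueness of its
    representation turns equality of values into equality of digits. *)
Lemma operand_of_eval (inX : 'I_n -> G) mu m (d : 'I_m -> G) (X Y : {set G}) m'
    (d' : 'I_m' -> G) (y : int) :
  operand_of inX mu d X -> (mu <= m)%N -> (ceil_div mu k <= m')%N ->
  Y \subset ~: inputs G -> depends_on Y [set v in codom d] ->
  (forall i, d' i \in Y :|: [set v in codom d]) ->
  (forall val, run s val ->
     represents s (val \o d') (block_poly s k (val \o d)).[y]) ->
  operand_of inX (ceil_div mu k) d' (X :|: Y).
Proof.
move=> [clX inpX inX_d val_d] le_mu le_m' sub_Y depY in_d' eval.
have dX v : v \in codom d -> v \in X by case/codomP=> i ->.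
split=> [v|v|i|val alpha hrun ha alpha0 val_inX].
- rewrite inE => /orP[vX|vY] u hu; rewrite inE; first by rewrite (clX v).
  by have := depY v vY u hu; rewrite !inE => /orP[->|/dX ->]; rewrite ?orbT.
- rewrite inE => /orP[/inpX//|/(subsetP sub_Y)]; by rewrite in_setC => /negPf ->.
- by have := in_d' i; rewrite !inE => /orP[->|/dX ->]; rewrite ?orbT.
have le_mu' := ceil_div_le mu k_gt1.
have val_dE : val \o d =1 (fun i : 'I_m => alpha i).
  by move=> i; apply: val_d val_inX i => // i /(leq_trans le_mu')/alpha0.
have := eval val hrun; rewrite (eq_block_poly s k val_dE).
rewrite (@block_poly_low s k m mu) ?le_mu' //; last by lia.
rewrite hornerC (value_widen s (leqnn _) alpha0) -(value_widen s le_m' alpha0).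
by move/represents_digits; apply.
Qed.

Lemma toom_children mu (N : problem G) : problem_at mu N -> (n0 < psize N)%N ->
  exists f : 'I_(npoints k) -> problem G,
  [/\ forall i, problem_at (ceil_div mu k) (f i),
      forall i, psteps (f i) \subset psteps N
    & forall i j, i != j -> [disjoint psteps (f i) & psteps (f j)]].
Proof.
case=> hyb /andP[le_mu le_size] sub_U opAN opBN lt_n0.
have [[]|[_ [t hsub]]] := hybrid_inv hyb; first by rewrite leqNgt lt_n0.
have k_gt0 : (0 < k)%N by lia.
have /setP coverE := toom_cover t.
have subUU i : subU t i \subset psteps N.
  apply/subsetP=> v hv; rewrite coverE !inE; do 2 (apply/orP; left); apply/orP; right.
  by apply/bigcupP; exists i.
have evA : evalA t \subset psteps N.
  by apply/subsetP=> v; rewrite coverE !inE => ->.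
have evB : evalB t \subset psteps N.
  by apply/subsetP=> v; rewrite coverE !inE => ->; rewrite orbT.
exists (fun i => Problem (subA t i) (subB t i) (subC t i) (subU t i)
  (sideA N :|: evalA t) (sideB N :|: evalB t)); split=> [i|//|i j]; last first.
  have := toom_disjoint t; rewrite pairwise_cat => /and3P[_ _].
  have i0 := i; rewrite pairwise_map => /(pairwiseP i0); rewrite size_enum_ord => dis.
  wlog lt_ij : i j / (i < j)%N => [wl|].
    have [/wl//|/wl ij|/val_inj ->] := ltngtP i j; last by rewrite eqxx.
    by rewrite eq_sym disjoint_sym.
  by move=> _; have := dis i j (ltn_ord i) (ltn_ord j) lt_ij; rewrite !nth_ord_enum.
have /andP[le_sz sz_le] := sz_bound (psize N) i.
have le_sz' : (ceil_div mu k <= sz (psize N) i)%N.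
  by apply: leq_trans le_sz; apply: leq_ceil_div.
split=> /=.
- exact: hsub.
- rewrite le_sz' /=; apply: leq_trans sz_le _.
  have le_e : (excess s k (x i) <= \max_i excess s k (x i))%N by apply: leq_bigmax.
  move: le_size; rewrite /slack; set e := \max_i _ in le_e *; move=> le_size.
  have := leq_ceil_div k le_size.
  (* Since [k >= 2], a slack of [2e+1] shrinks to at most [e+1] under division, and the new excess,
     at most [e], brings it back to at most [2e+1]. *)
  suff : (ceil_div (mu + e.*2.+1) k <= ceil_div mu k + e.+1)%N by lia.
  rewrite /ceil_div -ltnS; set q := (_ %/ k)%N; set q' := (_ %/ k)%N.
  rewrite ltn_divLR //.
  have : (mu + k.-1 < q'.+1 * k)%N by rewrite ltn_ceil.
  nia.
- exact: subset_trans (subUU i) sub_U.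
- apply: (operand_of_eval opAN le_mu le_sz').
  + exact: subset_trans evA sub_U.
  + exact: toom_evalA_dep.
  + exact: toom_subA_in.
  + by move=> val hrun; apply: toom_evalA.
apply: (operand_of_eval opBN le_mu le_sz').
+ exact: subset_trans evB sub_U.
+ exact: toom_evalB_dep.
+ exact: toom_subB_in.
by move=> val hrun; apply: toom_evalB.
Qed.

Definition level (mu l : nat) : nat := iter l (fun m => ceil_div m k) mu.

Definition disjoint_family (I : finType) (F : I -> problem G) : Prop :=
  forall i j, i != j -> [disjoint psteps (F i) & psteps (F j)].

(** While the unpadded size exceeds [n0], so does the actual one, and every problem has to be solved
    by a Toom step. Disjointness is inherited, since the interiors of the children lie in that of
    their parent. *)
Lemma toom_level mu (N : problem G) l : problem_at mu N ->
  (forall i, (i < l)%N -> (n0 < level mu i)%N) ->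
  exists (I : finType) (F : I -> problem G),
    [/\ #|I| = (npoints k ^ l)%N, disjoint_family F
      & forall i, problem_at (level mu l) (F i)].
Proof.
move=> atN; elim: l => [|l IHl] hl.
  exists unit, (fun=> N); split=> //; first by rewrite card_unit.
have [I [F [cardI disF atF]]] := IHl (fun i lt_i => hl i (ltnW lt_i)).
have child i : exists f : 'I_(npoints k) -> problem G,
    [/\ forall j, problem_at (level mu l.+1) (f j),
        forall j, psteps (f j) \subset psteps (F i)
      & forall j j', j != j' -> [disjoint psteps (f j) & psteps (f j')]].
  apply: toom_children => //; apply: leq_trans (hl l _) _ => //.
  by case/andP: (at_size (atF i)).
have [f hf] := fin_all_exists child.
exists (I * 'I_(npoints k))%type, (fun ij => f ij.1 ij.2); split.
- by rewrite card_prod card_ord cardI expnSr.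
- move=> [i j] [i' j'] /=; have [<-|neq_i] := eqVneq i i'.
    have [_ _ dis] := hf i; move=> neq; apply: dis.
    by apply: contraNneq neq => ->.
  have [_ sub _] := hf i; have [_ sub' _] := hf i' => _.
  exact: disjointW (sub j) (sub' j') (disF _ _ neq_i).
by move=> [i j] /=; have [hat _ _] := hf i.
Qed.

Lemma operand_of_le inX mu mu' m (d : 'I_m -> G) X : (mu' <= mu)%N ->
  operand_of inX mu d X -> operand_of inX mu' d X.
Proof.
move=> le_mu [clX inpX inX_d val_d]; split=> // val alpha hrun ha alpha0.
by apply: val_d => // i /(leq_trans le_mu)/alpha0.
Qed.

End Problems.

(** * The words needed to compute digits of a product *)

(** The digits of [s ^ j]. *)
Definition unit_digit (j i : nat) : int := (i == j)%:Z.

(** Multiplying by [s ^ j] shifts the digits by [j] positions without any carry, and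
    [j + mu <= 2 * m] leaves room for all of them. *)
Lemma shifted_digits (s m mu j : nat) (d : 'I_(2 * m) -> int) (alpha : nat -> int) :
  (forall i, 0 <= alpha i < s%:Z) -> (forall i, (mu <= i)%N -> alpha i = 0) ->
  (j < mu <= m)%N ->
  represents s d (value s (fun i : 'I_m => alpha i)
                  * value s (fun i : 'I_m => unit_digit j i)) ->
  forall t : 'I_(2 * m), d t = if (j <= t)%N then alpha (t - j)%N else 0.
Proof.
move=> ha alpha0 /andP[lt_j le_mu] hd.
pose gamma t := if (j <= t)%N then alpha (t - j)%N else 0.
suff eqv : value s (fun i : 'I_m => alpha i)
      * value s (fun i : 'I_m => unit_digit j i)
    = value s (fun t : 'I_(2 * m) => gamma t).
  rewrite eqv in hd; apply: (represents_digits _ hd) => t; rewrite /gamma.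
  by case: ifP => // _; have := ha 0; lia.
have -> : value s (fun i : 'I_m => unit_digit j i) = s%:Z ^+ j.
  rewrite /value (bigD1 (Ordinal (leq_trans lt_j le_mu))) //= big1 ?addr0.
    by rewrite /unit_digit eqxx mul1r.
  by move=> i; rewrite -val_eqE /= /unit_digit => /negPf ->; rewrite mul0r.
rewrite (value_widen s le_mu alpha0) /value.
rewrite -(big_mkord xpredT (fun t => gamma t * s%:Z ^+ t)).
rewrite (@big_cat_nat _ _ _ j) //=; last by lia.
rewrite [X in _ = X + _]big_nat [X in _ = X + _]big1; last first.
  by move=> t /andP[_ lt_tj]; rewrite /gamma ifF ?mul0r // leqNgt lt_tj.
rewrite add0r -{2}(add0n j) big_addn big_mkord.
rewrite -(@value_widen s (2 * m - j) mu alpha) //; last by lia.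
rewrite /value mulr_suml; apply: eq_bigr => i _.
by rewrite /gamma leq_addl addnK exprD mulrA.
Qed.

Lemma unit_digitP (s j i : nat) : (2 <= s)%N -> 0 <= unit_digit j i < s%:Z.
Proof. by rewrite /unit_digit; case: eqP; lia. Qed.

(** A signed digit takes fewer than [2 * s <= s ^ 2] values, so a word carries at most two free
    digits. *)
Lemma digit_count (s : nat) (T X : finType) (e : {ffun T -> 'I_s} -> X -> int) :
  (2 <= s)%N -> (forall f v, `|e f v| < s%:Z) ->
  (forall f f', e f =1 e f' -> f = f') -> (#|T| <= 2 * #|X|)%N.
Proof.
move=> hs he inj_e.
have lt_code f v : (absz (e f v + s%:Z)%R < 2 * s)%N.
  by have := he f v; lia.
pose code f : {ffun X -> 'I_(2 * s)} := [ffun v => Ordinal (lt_code f v)].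
have inj_code : injective code.
  move=> f f' /ffunP eq_ff'; apply: inj_e => v.
  have := congr1 val (eq_ff' v); rewrite !ffunE /=.
  by have := he f v; have := he f' v; lia.
have := leq_card code inj_code; rewrite !card_ffun !card_ord => le_card.
rewrite -(leq_exp2l _ _ hs); apply: leq_trans le_card _.
by rewrite expnM; case: (posnP #|X|) => [->//|X_gt0]; rewrite leq_exp2r //; nia.
Qed.

Section Extend.
Variables (s mu : nat) (S : {set 'I_mu}).
Hypothesis hs : (2 <= s)%N.

(** The digits at the positions of [S] are free and all others are 0; the sequence is indexed by
    [nat] to be used as an input of [run_exists]. *)
Definition extend (f : {ffun {i | i \in S} -> 'I_s}) (i : nat) : int :=
  if insub i is Some i' then
    if insub (i' : 'I_mu) is Some u then (f u : nat)%:Z else 0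
  else 0.

Lemma extendE f (u : {i | i \in S}) : extend f (val u : 'I_mu) = (f u : nat)%:Z.
Proof.
rewrite /extend; case: insubP => [i' _ /val_inj ->|]; last by rewrite ltn_ord.
by rewrite valK.
Qed.

Lemma extend_digit f i : 0 <= extend f i < s%:Z.
Proof.
have s_pos : 0 <= (0 : int) < s%:Z by lia.
rewrite /extend; case: insubP => [i' _ _|_] //.
by case: insubP => [u _ _|_] //; have := ltn_ord (f u); lia.
Qed.

Lemma extend_support f i : extend f i != 0 -> exists2 j : 'I_mu, j \in S & i = j.
Proof.
rewrite /extend; case: insubP => [i' _ <-|_]; last by rewrite eqxx.
by case: insubP => [u uS _ _|_]; [exists i' | rewrite eqxx].
Qed.

End Extend.

(** * Covering the digits of an operand by few shifts *)

Section Cover.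
Variables (mu : nat) (F Z : {set 'I_mu}).

(* The digits of A that appear at the positions Z of A * s ^ j, for j in js. *)
Definition shifts (js : seq 'I_mu) : {set 'I_mu} :=
  [set i in F | has (fun j : 'I_mu => [exists t in Z, (i + j == t :> nat)%N]) js].

Hypothesis Z_high : forall t, t \in Z -> (7 * mu < 8 * t.+1)%N.
Hypothesis F_large : (3 * mu <= 8 * #|F|)%N.

(** Averaging over [j]. Each [t] in [Z] is reached by exactly one shift from each [i <= t] in
    [F :\: S], and there are at least [mu / 8] such [i]: of the [3 * mu / 8] elements of [F], fewer
    than [mu / 8] are in [S] and fewer than [mu / 8] exceed [t]. *)
Lemma exists_shift (S : {set 'I_mu}) : (8 * #|S| < mu)%N ->
  exists j : 'I_mu, (#|Z| <= 8 * #|[set i in F :\: S |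
     [exists t in Z, (i + j == t :> nat)%N]]|)%N.
Proof.
move=> ltS.
pose N j := [set i in F :\: S | [exists t in Z, (i + j == t :> nat)%N]].
have [//|noj] := boolP [exists j : 'I_mu, (#|Z| <= 8 * #|N j|)%N].
  by move/existsP.
exfalso.
(* For a given [j], a position [i] reaches at most one [t], so nothing is counted twice. *)
have cardN j : #|N j| = (\sum_(t in Z) #|[set i in F :\: S | (i + j == t :> nat)%N]|)%N.
  rewrite -sum1_card.
  under [RHS]eq_bigr => t _ do rewrite -sum1_card big_mkcond.
  rewrite exchange_big big_mkcond; apply: eq_bigr => i _.
  rewrite !inE; case iF: (_ && (i \in F)); last first.
    by rewrite big1 // => t _; rewrite !inE iF.
  case: ifP => [/existsP[t /andP[tZ /eqP def_t]]|/negbT/existsPn not_t].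
    rewrite (bigD1 t) //= !inE iF def_t eqxx big1 // => t' /andP[_ neq_t].
    by rewrite !inE iF def_t /= val_eqE eq_sym (negPf neq_t).
  rewrite big1 // => t tZ; rewrite !inE iF /=; case: ifP => // eq_t.
  by have := not_t t; rewrite tZ eq_t.
have lower t : t \in Z ->
    (mu <= 8 * \sum_(j < mu) #|[set i in F :\: S | (i + j == t :> nat)%N]|)%N.
  move=> tZ; have hi := Z_high tZ.
  have -> : (\sum_(j < mu) #|[set i in F :\: S | (i + j == t :> nat)%N]|
      = #|[set i in F :\: S | (i <= t)%N]|)%N.
    rewrite -[RHS]sum1_card.
    under [LHS]eq_bigr => j _ do rewrite -sum1_card big_mkcond.
    rewrite exchange_big [RHS]big_mkcond; apply: eq_bigr => i _.
    rewrite !inE; case iF: (_ && (i \in F)); last first.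
      by rewrite big1 // => j _; rewrite !inE iF.
    case: leqP => [le_it|lt_ti].
      have lt_j : (t - i < mu)%N by have := ltn_ord t; lia.
      rewrite (bigD1 (Ordinal lt_j)) //= !inE iF /= subnKC // eqxx big1 // => j.
      rewrite -val_eqE /= => neq_j; rewrite !inE iF /=; case: eqP => // eq_t.
      by rewrite -eq_t addKn eqxx in neq_j.
    rewrite big1 // => j _; rewrite !inE iF /=; case: eqP => // eq_t.
    by move: lt_ti; rewrite -eq_t; lia.
  have cardT : (#|[set i : 'I_mu | (t < i)%N]| <= mu - t.+1)%N.
    have inj (i : {i : 'I_mu | (t < i)%N}) : (sval i - t.+1 < mu - t.+1)%N.
      by case: i => i /=; have := ltn_ord i; lia.
    rewrite cardsE -card_sig -[X in (_ <= X)%N]card_ord.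
    apply: (@leq_card _ _ (fun i => Ordinal (inj i))) => -[i hi'] [j hj] [eq_ij].
    by apply/val_inj/val_inj => /=; move: eq_ij => /=; lia.
  have sub : F \subset [set i in F :\: S | (i <= t)%N]
      :|: (S :|: [set i : 'I_mu | (t < i)%N]).
    apply/subsetP=> i iF; rewrite !inE iF /= andbT.
    by case: (i \in S) => //=; case: leqP.
  set Ti := [set i : 'I_mu | (t < i)%N] in cardT sub.
  have cardFT := leq_trans (subset_leq_card sub) (leq_of_leqif (leq_card_setU _ _)).
  have cardST := leq_of_leqif (leq_card_setU S Ti).
  move: (ltn_ord t) hi F_large ltS cardT cardFT cardST.
  by move: #|F| #|Ti| #|S :|: Ti| #|S| #|[set _ in _ | _]| => *; lia.
have mu_gt0 : (0 < mu)%N by lia.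
have up : (\sum_(j < mu) (8 * #|N j| + 1) <= mu * #|Z|)%N.
  have -> : (mu * #|Z| = \sum_(j < mu) #|Z|)%N by rewrite sum_nat_const card_ord.
  apply: leq_sum => j _.
  by rewrite addn1 ltnNge; move/existsPn: noj => /(_ j).
rewrite big_split /= sum1_card card_ord -big_distrr /= in up.
have : (mu * #|Z| <= 8 * \sum_(j < mu) #|N j|)%N.
  under eq_bigr do rewrite cardN.
  rewrite exchange_big /= big_distrr /= mulnC -sum_nat_const.
  by apply: leq_sum => t tZ; apply: lower.
by rewrite leqNgt (leq_trans _ up) // -addn1 leq_add2l.
Qed.

(** Greedy choice: as long as fewer than [mu / 8] digits are covered, [exists_shift] provides a
    shift covering at least [#|Z| / 8] new ones. *)
Lemma exists_cover r : (mu <= r * #|Z|)%N ->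
  exists2 js, (size js <= r)%N & (mu <= 8 * #|shifts js|)%N.
Proof.
suff [js le_js [?|?]] : exists2 js, (size js <= r)%N &
    (mu <= 8 * #|shifts js|)%N \/ (r * #|Z| <= 8 * #|shifts js|)%N.
- by exists js.
- by exists js => //; apply: leq_trans H _.
elim: r => [|r [js le_js hjs]]; first by exists [::] => //; right.
have [ge_mu|lt_mu] := leqP mu (8 * #|shifts js|).
  by exists js; [apply: leqW | left].
case: hjs => [|le_r]; first by rewrite leqNgt lt_mu.
have [j hj] := exists_shift lt_mu.
exists (j :: js) => //; right.
set N := [set _ in _ | _] in hj.
suff : (#|shifts js| + #|N| <= #|shifts (j :: js)|)%N by lia.
have <- : #|shifts js :|: N| = (#|shifts js| + #|N|)%N.
  rewrite cardsU disjoint_setI0 ?cards0 ?subn0 // disjoint_sym disjoints_subset.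
  by apply/subsetP=> i; rewrite !inE => /andP[/andP[]].
apply: subset_leq_card; apply/subsetP=> i; rewrite !inE /=.
by case/orP=> [/andP[-> ->]|/andP[/andP[_ ->] ->]] //; rewrite orbT.
Qed.

End Cover.

(** * Output digits computed by a segment against interior words known to it *)

Section Rate.
Variables (s n : nat) (G : cdag n).
Hypotheses (hs : (2 <= s)%N) (wfG : well_formed s G).
(** [X] and [Y] are the sides of the two operands and [U] the interior of the problem. The segment
    knows [K] and computes [E], including the output digits at the positions [Z]. The free digits of
    the operand on [inX] are those of [F], and the words of [Q] determine all that [K] contains of
    [X]. *)
Variables (inX inY : 'I_n -> G) (X Y U K E Q : {set G}).
Variables (mu : nat) (F Z : {set 'I_mu}) (c : 'I_mu -> G).

Definition supported (alpha : nat -> int) : Prop :=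
  (forall i, 0 <= alpha i < s%:Z) /\
  (forall i, alpha i != 0 -> exists2 j : 'I_mu, j \in F & i = j).

Hypothesis exists_run : forall alpha beta : nat -> int,
  (forall i, 0 <= alpha i < s%:Z) -> (forall i, 0 <= beta i < s%:Z) ->
  exists val : G -> int, [/\ run s val,
    forall i, val (inX i) = alpha i & forall i, val (inY i) = beta i].
Hypothesis closedX : forall v, v \in X -> {subset preds v <= X}.
Hypothesis closedY : forall v, v \in Y -> {subset preds v <= Y}.
Hypothesis closedU : depends_on U (X :|: Y).
Hypothesis inputsX : forall v, v \in X -> v \in inputs G -> v \in codom inX.
Hypothesis inputsY : forall v, v \in Y -> v \in inputs G -> v \in codom inY.
Hypothesis closedE : forall v, v \in E -> v \notin inputs G /\ {subset preds v <= K :|: E}.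
Hypothesis output : forall (val : G -> int) alpha (j : 'I_mu), run s val ->
  supported alpha -> (forall i, val (inX i) = alpha i) ->
  (forall i, val (inY i) = unit_digit j i) ->
  forall t : 'I_mu, val (c t) = if (j <= t)%N then alpha (t - j)%N else 0.
Hypothesis cU : forall t, c t \in U.
Hypothesis Z_computed : forall t, t \in Z -> c t \in E.
Hypothesis Z_high : forall t, t \in Z -> (7 * mu < 8 * t.+1)%N.
Hypothesis F_large : (3 * mu <= 8 * #|F|)%N.
Hypothesis QX : Q \subset X.
Hypothesis Q_small : (32 * #|Q| <= mu)%N.
Hypothesis known_X : forall (val val' : G -> int) alpha alpha',
  run s val -> run s val' -> supported alpha -> supported alpha' ->
  (forall i, val (inX i) = alpha i) -> (forall i, val' (inX i) = alpha' i) ->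
  {in Q, val =1 val'} -> {in K :&: X, val =1 val'}.

(* As B runs over the powers s ^ j, the digits of A met by the translates Z - j
   are all determined by the words of K: those on the side of Y do not depend on
   A, those on the side of X do not depend on j, so only the ones in U have to
   be counted once for each j. *)
Lemma output_rate : (#|Z| <= 64 * #|K :&: U|)%N.
Proof.
have [->|[t0 t0Z]] := set_0Vmem Z; first by rewrite cards0.
have Z_gt0 : (0 < #|Z|)%N by rewrite (cardD1 t0) t0Z.
have Z_le : (#|Z| <= mu)%N by rewrite -[X in (_ <= X)%N]card_ord max_card.
(* Enough shifts to cover a constant fraction of the digits, but [r * #|Z| <= 2 * mu]. *)
pose r := (mu %/ #|Z|).+1.
have [|js le_js cover] := @exists_cover mu F Z Z_high F_large r.
  by rewrite ltnW // ltn_ceil.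
set S := shifts F Z js in cover.
have SF i : i \in S -> i \in F by rewrite inE => /andP[].
have supp (f : {ffun {i | i \in S} -> 'I_s}) : supported (extend f).
  split=> [i|i /extend_support[j /SF jF ->]]; first exact: extend_digit.
  by exists j.
have choose (fj : {ffun {i | i \in S} -> 'I_s} * 'I_mu) : exists val : G -> int,
    [/\ run s val, forall i, val (inX i) = extend fj.1 i
      & forall i, val (inY i) = unit_digit fj.2 i].
  by apply: exists_run => i; rewrite ?extend_digit ?unit_digitP.
have [V hV] := fin_all_exists choose.
(* The words that encode the free digits: those of [Q] are read for a single power of [s], here
   [t0], and those interior to the problem once for each shift. *)
pose W := ({v | v \in Q} + 'I_(size js) * {v | v \in K :&: U})%type.
pose e f (w : W) : int := match w with
  | inl v => V (f, t0) (val v)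
  | inr (i, v) => V (f, nth t0 js i) (val v) end.
have bound_e f w : `|e f w| < s%:Z.
  have [_ _ _ _ _ word] := wfG.
  case: w => [v|[i v]] /=; first by have [/word] := hV (f, t0).
  by have [/word] := hV (f, nth t0 js i).
have inj_e f f' : e f =1 e f' -> f = f'.
  move=> eq_e; apply/ffunP => u; apply/val_inj.
  have := valP u; rewrite !inE => /andP[_ /hasP[j j_js /existsP[t /andP[tZ /eqP def_t]]]].
  have [run1 inX1 inY1] := hV (f, j); have [run2 inX2 inY2] := hV (f', j).
  have [run3 inX3 inY3] := hV (f, t0); have [run4 inX4 inY4] := hV (f', t0).
  (* The side of [X] does not see the second operand, so its values for the shift [j] are those for
     [t0]. *)
  have sideX g : {in X, V (g, j) =1 V (g, t0)}.
    have [r1 i1 _] := hV (g, j); have [r2 i2 _] := hV (g, t0).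
    apply: (agree_side wfG r1 r2 closedX) => v; rewrite inE => /andP[vX vI].
    by have /codomP[i ->] := inputsX vX vI; rewrite i1 i2.
  have agQ : {in Q, V (f, j) =1 V (f', j)}.
    move=> v vQ; have vX := subsetP QX v vQ.
    by rewrite !sideX //; apply: (eq_e (inl (exist _ v vQ))).
  have agX := known_X run1 run2 (supp f) (supp f') inX1 inX2 agQ.
  have agY : {in Y, V (f, j) =1 V (f', j)}.
    apply: (agree_side wfG run1 run2 closedY) => v; rewrite inE => /andP[vY vI].
    by have /codomP[i ->] := inputsY vY vI; rewrite inY1 inY2.
  have lt_j : (index j js < size js)%N by rewrite index_mem.
  have agU : {in K :&: U, V (f, j) =1 V (f', j)}.
    move=> v vKU; have := eq_e (inr (Ordinal lt_j, exist _ v vKU)).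
    by rewrite /e /= nth_index.
  have ag : {in (K :|: E) :&: (U :|: (X :|: Y)), V (f, j) =1 V (f', j)}.
    apply: (agree_closed wfG run1 run2 closedE) => v.
      rewrite !inE => /or3P[vU|vX|vY] w hw; rewrite !inE.
      - by have := closedU vU hw; rewrite !inE.
      - by rewrite (closedX vX hw) orbT.
      by rewrite (closedY vY hw) !orbT.
    rewrite !inE => /andP[vK /or3P[vU|vX|vY]].
    - by apply: agU; rewrite inE vK.
    - by apply: agX; rewrite inE vK.
    exact: agY.
  have := ag (c t); rewrite !inE Z_computed // cU orbT => /(_ isT).
  rewrite (output run1 (supp f) inX1 inY1) (output run2 (supp f') inX2 inY2).
  rewrite /= -def_t leq_addl addnK !extendE; exact: (can_inj absz_nat).
have := digit_count hs bound_e inj_e.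
have card_sub (T : finType) (A : {set T}) : #|{: {v | v \in A}}| = #|A|.
  by rewrite card_sig; apply: eq_card.
rewrite card_sum card_prod card_ord !card_sub => count.
have r_le : (r * #|Z| <= 2 * mu)%N.
  by rewrite /r mulSn; have := leq_trunc_div mu #|Z|; lia.
have : (mu * #|Z| <= mu * (64 * #|K :&: U|))%N.
  (* Counting gives [mu <= 8 * #|S| <= 16 * (#|Q| + r * #|K :&: U|)], and [16 * #|Q|] is at most
     [mu / 2]. Multiplying by [#|Z|] and using [r * #|Z| <= 2 * mu] yields the factor 64. *)
  have mu_le : (mu <= 32 * (r * #|K :&: U|))%N.
    move: cover count Q_small (leq_mul le_js (leqnn #|K :&: U|)).
    by move: #|S| #|Q| (size js * #|K :&: U|)%N (r * #|K :&: U|)%N => *; lia.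
  apply: leq_trans (leq_mul mu_le (leqnn _)) _.
  rewrite -mulnA mulnAC; apply: leq_trans (_ : 32 * (2 * mu * #|K :&: U|) <= _)%N.
    by rewrite leq_mul2l leq_mul.
  by lia.
by rewrite leq_pmul2l //; apply: leq_trans Z_le.
Qed.

End Rate.

(** * Executions and their segments *)

Section Machine.
Variables (n : nat) (G : cdag n) (P M : nat) (L0 : 'I_P -> {set G}).

(* [S] contains all that was ever in the shared memory or sent, [w] is the
   number of the words moved so far. *)
Inductive machine : ('I_P -> {set G}) -> {set G} -> {set G} -> nat -> Prop :=
| machine_start : machine L0 (inputs G) set0 0
| machine_compute L S D w p v (L' : 'I_P -> {set G}) :
    machine L S D w -> v \notin inputs G -> {subset preds v <= L p} ->
    L' p \subset v |: L p -> (#|L' p| <= M)%N ->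
    (forall i, i != p -> L' i = L i) -> machine L' S (v |: D) w
| machine_load L S D w p (W : {set G}) (L' : 'I_P -> {set G}) :
    machine L S D w -> W \subset S -> (#|W| <= M)%N ->
    L' p \subset L p :|: W -> (#|L' p| <= M)%N ->
    (forall i, i != p -> L' i = L i) -> machine L' S D (w + #|W|)
| machine_store L S D w p (W : {set G}) :
    machine L S D w -> W \subset L p -> (#|W| <= M)%N ->
    machine L (S :|: W) D (w + #|W|).

Hypothesis L0_inputs : forall p, L0 p \subset inputs G.
Hypothesis L0_small : forall p, (#|L0 p| <= M)%N.

Lemma machine_small L S D w : machine L S D w -> forall p, (#|L p| <= M)%N.
Proof.
elim=> {L S D w} // L S D w p.
  move=> v L' _ IH _ _ _ small same i.
  by have [->|/same ->] := eqVneq i p.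
move=> W L' _ IH _ _ _ small same i.
by have [->|/same ->] := eqVneq i p.
Qed.

(* A segment (K, E, W) of the activity of one processor: K is what it has in
   memory at the start or receives, E what it computes, and W what it sends or
   still has in memory at the end. *)
Definition segment : Type := ({set G} * {set G} * {set G})%type.
Definition known (g : segment) : {set G} := g.1.1.
Definition computed (g : segment) : {set G} := g.1.2.
Definition kept (g : segment) : {set G} := g.2.

Definition segment_ok (K E : {set G}) : Prop :=
  forall v, v \in E -> v \notin inputs G /\ {subset preds v <= K :|: E}.

Lemma segment_okS (K K' E : {set G}) : segment_ok K E -> K \subset K' -> segment_ok K' E.
Proof.
move=> ok sub v /ok[vI hp]; split=> // u /hp; rewrite !inE.
by case/orP=> [/(subsetP sub)|] ->; rewrite ?orbT.
Qed.

Lemma segment_okU (K E : {set G}) v : segment_ok K E -> v \notin inputs G ->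
  {subset preds v <= K :|: E} -> segment_ok K (v |: E).
Proof.
move=> ok vI hv u; rewrite in_setU1 => /orP[/eqP ->|uE].
  by split=> // t /hv; rewrite !inE => /orP[] ->; rewrite ?orbT.
have [uI hu] := ok u uE; split=> // t /hu; rewrite !inE.
by case/orP=> ->; rewrite ?orbT.
Qed.

(** The whole activity of a processor is taken as one segment, whatever its length; it knows its
    initial memory and the words it received. *)
Lemma machine_single L S D w : machine L S D w ->
  exists K E : 'I_P -> {set G},
  [/\ forall p, segment_ok (K p) (E p), forall p, L p \subset K p :|: E p,
      forall v, v \in D -> exists p, v \in E p,
      forall p, L0 p \subset K p & (\sum_p #|K p :\: L0 p| <= w)%N].
Proof.
elim=> {L S D w} [|L S D w p v L' _ [K [E [ok sub cov init cost]]] vI pre hL' _ same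
  |L S D w p W L' _ [K [E [ok sub cov init cost]]] WS _ hL' _ same
  |L S D w p W _ [K [E [ok sub cov init cost]]] _ _].
- exists L0, (fun=> set0); split=> // [p v|p|v|]; rewrite ?inE ?setU0 //.
  by rewrite big1 // => p _; rewrite setDv cards0.
- exists K, (fun i => if i == p then v |: E i else E i); split=> // [i|i|u].
  + case: eqP => // ->; apply: segment_okU => // u /pre.
    exact: subsetP (sub p) u.
  + case: eqP => [->|/eqP /same -> //]; apply: subset_trans hL' _.
    by rewrite setUCA setUS.
  rewrite !inE => /orP[/eqP ->|/cov[i uE]]; first by exists p; rewrite eqxx setU11.
  by exists i; case: ifP; rewrite ?in_setU1 uE ?orbT.
- exists (fun i => if i == p then K i :|: W else K i), E; split=> // [i|i|i|].
  + by case: eqP => // _; apply: segment_okS (subsetUl _ _).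
  + case: eqP => [->|/eqP /same -> //]; apply: subset_trans hL' _.
    by rewrite setUAC setSU.
  + by case: eqP => // _; apply: subset_trans (subsetUl _ _).
  rewrite (bigD1 p) //= eqxx; move: cost; rewrite (bigD1 p) //=.
  set A := (\sum_(i | i != p) _)%N; set B := (\sum_(i | i != p) _)%N.
  have -> : B = A by apply: eq_bigr => i /negPf ->.
  have : (#|(K p :|: W) :\: L0 p| <= #|K p :\: L0 p| + #|W|)%N.
    rewrite setDUl; apply: leq_trans (leq_of_leqif (leq_card_setU _ _)) _.
    by rewrite leq_add2l subset_leq_card // subsetDl.
  by move: #|_| #|_| #|_| => *; lia.
by exists K, E; split=> //; apply: leq_trans cost (leq_addr _ _).
Qed.

(** Paths descend through successive operands. They may not end at an input, so that no path starts
    at an input and inputs are trivially covered. *)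
Definition dag_path (v : G) (p : seq G) : bool :=
  path (fun u t => t \in preds u) v p && (last v p \notin inputs G).

(** The part of the path from [u] to its end was computed within the single segment [g], and [u]
    outlived it: the computation at the end of the path can be charged to the kept vertex [u]. *)
Definition covered_from (gs : seq segment) (v : G) (p : seq G) : Prop :=
  exists2 g, g \in gs & exists u p1 p2,
    [/\ v :: p = p1 ++ u :: p2, {subset u :: p2 <= computed g} & u \in kept g].

Definition covered (gs : seq segment) (v : G) : Prop :=
  forall p, dag_path v p -> covered_from gs v p.

Definition extends (gs gs' : seq segment) : Prop :=
  forall g, g \in gs -> exists2 g', g' \in gs' &
    computed g \subset computed g' /\ kept g \subset kept g'.

Lemma covered_extends gs gs' v : extends gs gs' -> covered gs v -> covered gs' v.
Proof.
move=> ext cov p /cov[g /ext[g' g'in [/subsetP subE /subsetP subK]] [u [p1 [p2 [def_p hE hK]]]]].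
exists g' => //; exists u, p1, p2; split=> //; last exact: subK.
by move=> t /hE/subE.
Qed.

(** Each operand of a computed vertex is again known or computed. The first known vertex met on the
    path is covered, hence so is the path; if none is met, the path stays in [E]. *)
Lemma path_segment gs K E v p : segment_ok K E ->
  (forall u, u \in K -> covered gs u) -> v \in K :|: E -> dag_path v p ->
  {subset v :: p <= E} \/ covered_from gs v p.
Proof.
move=> ok covK; elim: p v => [|t p IHp] v.
  move=> vKE vp; move: vKE; rewrite inE => /orP[/covK/(_ _ vp)|vE]; first by right.
  by left=> u; rewrite inE => /eqP ->.
move=> vKE vp; move: vKE; rewrite inE => /orP[/covK/(_ _ vp)|vE]; first by right.
have [_ /(_ t) hpre] := ok v vE; move: vp; rewrite /dag_path /= -andbA => /and3P[/hpre tKE pp lp].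
have [|sub|[g gin [u [p1 [p2 [def_p hE hK]]]]]] := IHp t tKE; first by rewrite /dag_path pp.
  by left=> u; rewrite inE => /orP[/eqP ->|/sub].
by right; exists g => //; exists u, (v :: p1), p2; rewrite def_p.
Qed.

Hypothesis inputs_sources : forall v, v \in inputs G -> preds v = [::].

Lemma covered_input gs v : v \in inputs G -> covered gs v.
Proof.
move=> vI [|t p]; rewrite /dag_path /=; first by rewrite vI.
by rewrite inputs_sources.
Qed.

(** The first term serves the Toom levels, where known interior words are counted, the second the
    standard algorithms, where kept vertices are. Leaving out the inputs makes the initial memories
    free. *)
Definition cost (g : segment) : nat := (#|known g :\: inputs G| + #|kept g|)%N.

Definition segs (H : seq segment) (cur : 'I_P -> segment) : seq segment :=
  H ++ codom cur.

Definition upd (cur : 'I_P -> segment) p g : 'I_P -> segment :=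
  fun i => if i == p then g else cur i.

(* [H] lists the closed segments, [cur p] is the current one of [p], during
   which [r p] words have been moved so far. The term [2 * r p] pays for closing
   that segment, when the memory of [p] becomes both kept and known. *)
Record invariant (L : 'I_P -> {set G}) (S D : {set G}) (w : nat)
    (H : seq segment) (cur : 'I_P -> segment) (r : 'I_P -> nat) : Prop := Invariant {
  inv_ok : forall g, g \in segs H cur -> segment_ok (known g) (computed g);
  inv_local : forall p, L p \subset known (cur p) :|: computed (cur p);
  inv_done : forall v, v \in D -> exists2 g, g \in segs H cur & v \in computed g;
  inv_stored : forall v, v \in S -> covered (segs H cur) v;
  inv_known : forall g v, g \in segs H cur -> v \in known g -> covered (segs H cur) v;
  inv_closed : forall g, g \in H -> (#|known g| <= 3 * M)%N;
  inv_current : forall p, (#|known (cur p)| <= M + r p)%N;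
  inv_cost : (\sum_(g <- H) cost g + \sum_p (cost (cur p) + 2 * r p) <= 3 * w)%N
}.

Lemma extends_upd H cur p g : computed (cur p) \subset computed g ->
  kept (cur p) \subset kept g -> extends (segs H cur) (segs H (upd cur p g)).
Proof.
move=> subE subK g0; rewrite mem_cat => /orP[g0H|/codomP[i ->]].
  by exists g0 => //; rewrite mem_cat g0H.
exists (upd cur p g i); first by rewrite mem_cat codom_f orbT.
by rewrite /upd; case: eqP => // ->.
Qed.

Lemma mem_segs H cur i : cur i \in segs H cur.
Proof. by rewrite mem_cat codom_f orbT. Qed.

Lemma mem_upd H cur p g g0 : g0 \in segs H (upd cur p g) ->
  g0 = g \/ g0 \in segs H cur.
Proof.
rewrite mem_cat => /orP[g0H|/codomP[i ->]]; first by right; rewrite mem_cat g0H.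
by rewrite /upd; case: eqP; [left | right; apply: mem_segs].
Qed.

Lemma upd_in H cur p g : g \in segs H (upd cur p g).
Proof. by have := mem_segs H (upd cur p g) p; rewrite {1}/upd eqxx. Qed.

Lemma inv_start : invariant L0 (inputs G) set0 0 [::]
  (fun p => (L0 p, set0, set0)) (fun=> 0%N).
Proof.
have segsE g : g \in segs [::] (fun p => (L0 p, set0, set0)) ->
    exists p, g = (L0 p, set0, set0) by move=> /codomP.
split=> //.
- by move=> g /segsE[p ->] v; rewrite inE.
- by move=> p; apply: subsetUl.
- by move=> v; rewrite inE.
- by move=> v /covered_input.
- by move=> g v /segsE[p ->] /(subsetP (L0_inputs p))/covered_input.
- by move=> p; rewrite addn0 L0_small.
rewrite big_nil big1 // => p _; rewrite /cost /known /kept /= cards0.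
by have := L0_inputs p; rewrite -setD_eq0 => /eqP ->; rewrite cards0.
Qed.

Lemma sum_upd cur (r : 'I_P -> nat) p g c :
  (\sum_i (cost (upd cur p g i) + 2 * (if i == p then c else r i))
    + (cost (cur p) + 2 * r p)
   = \sum_i (cost (cur i) + 2 * r i) + (cost g + 2 * c))%N.
Proof.
rewrite (bigD1 p) //= {1}/upd eqxx [in RHS](bigD1 p) //=.
rewrite (eq_bigr (fun i => (cost (cur i) + 2 * r i)%N)); first by lia.
by move=> i /negPf neq; rewrite /upd neq.
Qed.

Lemma inv_compute L S D w H cur r p v (L' : 'I_P -> {set G}) : invariant L S D w H cur r ->
  v \notin inputs G -> {subset preds v <= L p} -> L' p \subset v |: L p ->
  (forall i, i != p -> L' i = L i) ->
  invariant L' S (v |: D) w H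
    (upd cur p (known (cur p), v |: computed (cur p), kept (cur p))) r.
Proof.
case=> ok loc dn st kn cl cu co vI pre hL' same.
set g := (known _, _, _).
have ext : extends (segs H cur) (segs H (upd cur p g)).
  by apply: extends_upd => //; apply: subsetUr.
have sub_p := subsetP (loc p).
split=> //.
- move=> g0 /mem_upd[->|/ok //]; apply: segment_okU => //.
    by apply: ok; apply: mem_segs.
  by move=> u /pre/sub_p.
- move=> i; rewrite /upd; case: eqP => [->|/eqP/same -> //].
  by apply: subset_trans hL' _; rewrite setUCA setUS.
- move=> u; rewrite !inE => /orP[/eqP ->|/dn[g0 /ext[g1 g1in [subE _]] ug0]].
    by exists g; [apply: upd_in | rewrite /computed setU11].
  by exists g1 => //; apply: (subsetP subE).
- by move=> u /st; apply: covered_extends.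
- move=> g0 u /mem_upd[->|g0in] uk; apply: (covered_extends ext).
    by apply: (kn (cur p)) => //; apply: mem_segs.
  exact: kn uk.
- by move=> i; rewrite /upd; case: eqP => [->|_]; apply: cu.
rewrite (eq_bigr (fun i => (cost (cur i) + 2 * r i)%N)) // => i _.
by rewrite /upd; case: eqP => // ->.
Qed.

(** Each word moved raises the cost of the current segment by at most 1 and [2 * r p] by 2, whence
    the factor 3 in [inv_cost]; the same count applies to a store. *)
Lemma inv_load L S D w H cur r p (W : {set G}) (L' : 'I_P -> {set G}) : invariant L S D w H cur r ->
  W \subset S -> L' p \subset L p :|: W ->
  (forall i, i != p -> L' i = L i) ->
  invariant L' S D (w + #|W|) H
    (upd cur p (known (cur p) :|: W, computed (cur p), kept (cur p)))
    (fun i => if i == p then r i + #|W| else r i)%N.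
Proof.
case=> ok loc dn st kn cl cu co WS hL' same.
set g := (_ :|: _, _, _).
have ext : extends (segs H cur) (segs H (upd cur p g)).
  by apply: extends_upd.
have card_g : (#|known g| <= #|known (cur p)| + #|W|)%N.
  exact: leq_of_leqif (leq_card_setU _ _).
split=> //.
- move=> g0 /mem_upd[->|/ok //]; apply: segment_okS (subsetUl _ _).
  by apply: ok; apply: mem_segs.
- move=> i; rewrite /upd; case: eqP => [->|/eqP/same -> //].
  by apply: subset_trans hL' _; rewrite setUAC setSU.
- move=> u /dn[g0 /ext[g1 g1in [subE _]] ug0].
  by exists g1 => //; apply: (subsetP subE).
- by move=> u /st; apply: covered_extends.
- move=> g0 u /mem_upd[->|g0in] uk; apply: (covered_extends ext).
    move: uk; rewrite /known inE => /orP[uk|/(subsetP WS)/st //].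
    by apply: (kn (cur p)) => //; apply: mem_segs.
  exact: kn uk.
- move=> i; rewrite /upd; case: eqP => [->|_]; last exact: cu.
  by rewrite addnA; apply: leq_trans card_g _; rewrite leq_add2r.
have -> : (\sum_i (cost (upd cur p g i) + 2 * (if i == p then r i + #|W| else r i))
    = \sum_i (cost (upd cur p g i) + 2 * (if i == p then r p + #|W| else r i)))%N.
  by apply: eq_bigr => i _; case: eqP => // ->.
have := sum_upd cur r p g (r p + #|W|).
have : (cost g <= cost (cur p) + #|W|)%N.
  rewrite /cost addnAC leq_add2r /g /known /= setDUl.
  apply: leq_trans (leq_of_leqif (leq_card_setU _ _)) _.
  by rewrite leq_add2l subset_leq_card // subsetDl.
move: co; set X := (\sum_(i < P) _)%N; set X' := (\sum_(i < P) _)%N.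
set Y := (\sum_(_ <- _) _)%N; lia.
Qed.

Lemma inv_store L S D w H cur r p (W : {set G}) : invariant L S D w H cur r ->
  W \subset L p ->
  invariant L (S :|: W) D (w + #|W|) H
    (upd cur p (known (cur p), computed (cur p), kept (cur p) :|: W))
    (fun i => if i == p then r i + #|W| else r i)%N.
Proof.
case=> ok loc dn st kn cl cu co WL.
set g := (known _, _, _).
have ext : extends (segs H cur) (segs H (upd cur p g)).
  by apply: extends_upd => //; apply: subsetUl.
have sub_p := subsetP (subset_trans WL (loc p)).
split=> //.
- move=> g0 /mem_upd[->|/ok //].
  exact: (ok _ (mem_segs H cur p)).
- by move=> i; rewrite /upd; case: eqP => [->|_]; apply: loc.
- move=> u /dn[g0 /ext[g1 g1in [subE _]] ug0].
  by exists g1 => //; apply: (subsetP subE).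
(* A path from a word being stored either lies within the current segment, which now keeps that
   word, or meets a known word, which is covered already. *)
- move=> u; rewrite inE => /orP[/st|uW]; first exact: covered_extends.
  move=> q uq; have ok_p := ok _ (mem_segs H cur p).
  have known_p t : t \in known (cur p) -> covered (segs H (upd cur p g)) t.
    by move=> tk; apply: (covered_extends ext); apply: kn tk; apply: mem_segs.
  have [sub|//] := path_segment ok_p known_p (sub_p u uW) uq.
  exists g; first exact: upd_in.
  by exists u, [::], q; split=> //; rewrite /g /kept /= inE uW orbT.
- move=> g0 u /mem_upd[->|g0in] uk; apply: (covered_extends ext).
    by apply: (kn (cur p)) => //; apply: mem_segs.
  exact: kn uk.
- move=> i; rewrite /upd; case: eqP => [->|_]; last exact: cu.
  by rewrite addnA; apply: leq_trans (cu p) _; rewrite leq_addr.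
have -> : (\sum_i (cost (upd cur p g i) + 2 * (if i == p then r i + #|W| else r i))
    = \sum_i (cost (upd cur p g i) + 2 * (if i == p then r p + #|W| else r i)))%N.
  by apply: eq_bigr => i _; case: eqP => // ->.
have := sum_upd cur r p g (r p + #|W|).
have : (cost g <= cost (cur p) + #|W|)%N.
  rewrite /cost -addnA leq_add2l /g /kept /=.
  exact: leq_of_leqif (leq_card_setU _ _).
move: co; set X := (\sum_(i < P) _)%N; set X' := (\sum_(i < P) _)%N.
set Y := (\sum_(_ <- _) _)%N; lia.
Qed.

(** The at most [M] words in memory are counted twice, as kept by the old segment and as known by
    the new one; [2 * r p >= 2 * M] pays for both. The closed segment knows at most
    [M + r p <= 3 * M] words. *)
Lemma inv_close L S D w H cur r p : invariant L S D w H cur r ->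
  (#|L p| <= M)%N -> (M <= r p <= 2 * M)%N ->
  invariant L S D w ((known (cur p), computed (cur p), kept (cur p) :|: L p) :: H)
    (upd cur p (L p, set0, set0)) (fun i => if i == p then 0%N else r i).
Proof.
case=> ok loc dn st kn cl cu co smallL /andP[le_r r_le].
set g := (known _, _, _); set g' := (L p, _, _).
pose gs := segs (g :: H) (upd cur p g').
have g_in : g \in gs by rewrite mem_cat mem_head.
have ext : extends (segs H cur) gs.
  move=> g0; rewrite mem_cat => /orP[g0H|/codomP[i ->]].
    by exists g0 => //; rewrite mem_cat inE g0H orbT.
  have [->|neq] := eqVneq i p; first by exists g => //; split=> //; apply: subsetUl.
  exists (cur i) => //; have := mem_segs (g :: H) (upd cur p g') i.
  by rewrite {1}/upd (negPf neq).
have mem_gs g0 : g0 \in gs -> [\/ g0 = g, g0 = g' | g0 \in segs H cur].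
  case/mem_upd=> [|]; first by constructor 2.
  rewrite mem_cat inE -orbA => /or3P[/eqP|g0H|g0c]; first by constructor 1.
    by constructor 3; rewrite mem_cat g0H.
  by constructor 3; rewrite mem_cat g0c orbT.
have ok_p := ok _ (mem_segs H cur p).
have known_p t : t \in known (cur p) -> covered gs t.
  by move=> tk; apply: (covered_extends ext); apply: kn tk; apply: mem_segs.
split=> //.
- by move=> g0 /mem_gs[->|->|/ok //] // v; rewrite inE.
- by move=> i; rewrite /upd; case: eqP => [->|_]; [apply: subsetUl | apply: loc].
- move=> u /dn[g0 /ext[g1 g1in [subE _]] ug0].
  by exists g1 => //; apply: (subsetP subE).
- by move=> u /st; apply: covered_extends.
- move=> g0 u /mem_gs[->|->|g0in] uk; last by apply: (covered_extends ext); apply: kn uk.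
    exact: known_p.
  move=> q uq; have [sub|//] := path_segment ok_p known_p (subsetP (loc p) u uk) uq.
  by exists g => //; exists u, [::], q; split=> //; rewrite /g /kept /= inE uk orbT.
- move=> g0; rewrite inE => /orP[/eqP ->|/cl //].
  by apply: leq_trans (cu p) _; lia.
- move=> i; rewrite /upd; case: eqP => [_|_]; last exact: cu.
  by rewrite addn0.
rewrite big_cons.
have := sum_upd cur r p g' 0.
have : (cost g <= cost (cur p) + M)%N.
  rewrite /cost -addnA leq_add2l /g /kept /=.
  by apply: leq_trans (leq_of_leqif (leq_card_setU _ _)) _; rewrite leq_add2l.
have : (cost g' <= M)%N.
  rewrite /cost /g' /known /kept /= cards0 addn0.
  by apply: leq_trans smallL; rewrite subset_leq_card // subsetDl.
move: co; set X := (\sum_(i < P) _)%N; set X' := (\sum_(i < P) _)%N.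
set Y := (\sum_(_ <- _) _)%N; lia.
Qed.

(** A single operation moves at most [M] words, so [r p], below [M] before it, cannot exceed
    [2 * M]; closing the segment of [p] if necessary restores the bound. *)
Lemma inv_settle L S D w H cur r p : invariant L S D w H cur r ->
  (forall i, (#|L i| <= M)%N) ->
  (forall i, i != p -> (r i < M)%N) -> (r p <= 2 * M)%N -> (0 < M)%N ->
  exists H' cur' r', invariant L S D w H' cur' r' /\ (forall i, (r' i < M)%N).
Proof.
move=> inv small lt_r le_rp M_gt0; have [lt_rp|ge_rp] := ltnP (r p) M.
  by exists H, cur, r; split=> // i; have [->|/lt_r] := eqVneq i p.
do 2!eexists; exists (fun i => if i == p then 0%N else r i); split.
  by apply: (inv_close inv) => //; rewrite ge_rp.
by move=> i /=; case: eqP => [//|/eqP/lt_r].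
Qed.

Hypothesis M_gt0 : (0 < M)%N.

Lemma machine_invariant L S D w : machine L S D w ->
  exists H cur r, invariant L S D w H cur r /\ (forall i, (r i < M)%N).
Proof.
elim=> {L S D w}.
- by exists [::], (fun p => (L0 p, set0, set0)), (fun=> 0%N); split=> //; apply: inv_start.
- move=> L S D w p v L' _ [H [cur [r [inv lt_r]]]] vI pre hL' _ same.
  by exists H; eexists; exists r; split=> //; apply: (inv_compute inv vI pre hL' same).
- move=> L S D w p W L' hm [H [cur [r [inv lt_r]]]] WS leW hL' small same.
  apply: (inv_settle (p := p)) (inv_load inv WS hL' same) _ _ _ M_gt0.
  + move=> i; have [->|/same ->] := eqVneq i p; first exact: small.
    exact: machine_small hm i.
  + by move=> i /negPf ->.
  by rewrite eqxx; have := lt_r p; lia.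
move=> L S D w p W hm [H [cur [r [inv lt_r]]]] WL leW.
apply: (inv_settle (p := p)) (inv_store inv WL) _ _ _ M_gt0.
+ exact: machine_small hm.
+ by move=> i /negPf ->.
by rewrite eqxx; have := lt_r p; lia.
Qed.

Theorem machine_segments L S D w : machine L S D w ->
  exists gs : seq segment,
  [/\ forall g, g \in gs -> segment_ok (known g) (computed g),
      forall g, g \in gs -> (#|known g| <= 3 * M)%N,
      forall v, v \in D -> exists2 g, g \in gs & v \in computed g,
      forall g v p, g \in gs -> v \in computed g -> dag_path v p ->
        {subset v :: p <= computed g} \/ covered_from gs v p
    & (\sum_(g <- gs) cost g <= 3 * w)%N].
Proof.
move=> /machine_invariant[H [cur [r [[ok _ dn _ kn cl cu co] lt_r]]]].
exists (segs H cur); split=> //.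
- move=> g; rewrite mem_cat => /orP[/cl //|/codomP[p ->]].
  by apply: leq_trans (cu p) _; have := lt_r p; lia.
- move=> g v p g_in vg vp; apply: (path_segment (ok g g_in)) vp; last by rewrite inE vg orbT.
  by move=> u; apply: kn.
rewrite big_cat /= big_image /=; apply: leq_trans co.
by rewrite leq_add2l; apply: leq_sum => p _; apply: leq_addr.
Qed.

End Machine.

(** The sequential model is a machine with one processor and an empty initial memory; [S] only
    grows, so it still contains words that the slow memory has overwritten. *)
Lemma seq_exec_machine (n : nat) (G : cdag n) (M B : nat) (C : {set G})
    (mem : nat -> option G) (D : {set G}) (q : nat) :
  (B <= M)%N -> seq_exec M B C mem D q ->
  exists (L : 'I_1 -> {set G}) (S : {set G}) (w : nat),
    [/\ machine M (fun=> set0) L S D w, L ord0 = C,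
        forall addr v, mem addr = Some v -> v \in S & (w <= B * q)%N].
Proof.
move=> le_B; elim=> {C mem D q}
  [mem mem_in _|C mem D q v C' _ [L [S [w [hm <- hS hw]]]] vI pre vC' sub small
  |C mem D q addr len C' _ [L [S [w [hm <- hS hw]]]] le_len sub small
  |C mem D q addr W _ [L [S [w [hm <- hS hw]]]] le_W WC].
- by exists (fun=> set0), (inputs G), 0%N; split=> //; apply: machine_start.
- exists (fun=> C'), S, w; split=> //.
  by apply: (machine_compute (p := ord0) hm) => // i; rewrite ord1.
- set W := [set v | _] in sub.
  (* Distinct vertices found in the block come from distinct addresses. *)
  have cardW : (#|W| <= len)%N.
    have pick (v : {v | v \in W}) : exists i : 'I_len, mem (addr + i)%N = Some (val v).
      by have := valP v; rewrite inE => /existsP[i /eqP]; exists i.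
    have [f hf] := fin_all_exists pick.
    have inj_f : injective f.
      move=> u v eq_f; apply/val_inj; have := hf u; rewrite eq_f hf.
      by move=> [].
    by have := leq_card f inj_f; rewrite card_ord card_sig (eq_card (B := W)).
  exists (fun=> C'), S, (w + #|W|)%N; split=> //; last by rewrite mulnS; lia.
  apply: (machine_load (p := ord0) hm) => //; last by move=> i; rewrite ord1.
    by apply/subsetP=> v; rewrite inE => /existsP[i /eqP/hS].
  by lia.
set V := [set v in W].
have cardV : (#|V| <= B)%N.
  by apply: leq_trans le_W; rewrite cardsE; apply: card_size.
exists L, (S :|: V), (w + #|V|)%N; split=> //; last by rewrite mulnS; lia.
  apply: (machine_store (p := ord0) hm); last by lia.
  by apply/subsetP=> v; rewrite inE => /WC.
move=> i v; rewrite !inE; case: ifP => [_|_ /hS -> //].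
have [lt_i|le_i] := ltnP (i - addr) (size W); last by rewrite nth_default ?size_map.
by rewrite (nth_map v) // => -[<-]; rewrite mem_nth ?orbT.
Qed.

(** A message is a store by the sender followed by a load by the receiver: it moves its words twice,
    and is counted at both ends. *)
Lemma par_exec_machine (n : nat) (G : cdag n) (P M Bm : nat)
    (L : 'I_P -> {set G}) (D : {set G}) (q : 'I_P -> nat) :
  (Bm <= M)%N -> par_exec M Bm L D q ->
  exists (L0 : 'I_P -> {set G}) (S : {set G}) (w : nat),
    [/\ distributed M L0, machine M L0 L S D w & (w <= Bm * \sum_p q p)%N].
Proof.
move=> le_Bm; elim=> {L D q}
  [L dist|L D q p v S' _ [L0 [S [w [dist hm hw]]]] vI pre vS' sub small
  |L D q p p' W S' _ [L0 [S [w [dist hm hw]]]] neq WL cardW sub small].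
- by exists L, (inputs G), 0%N; split=> //; apply: machine_start.
- exists L0, S, w; split=> //.
  by apply: (machine_compute (p := p) hm) => //= [||i /negPf ->]; rewrite ?eqxx.
exists L0, (S :|: W), (w + #|W| + #|W|)%N; split=> //.
  have hm' := machine_store hm WL (leq_trans cardW le_Bm).
  apply: (machine_load (p := p') hm') => //=; rewrite ?eqxx ?subsetUr //.
    exact: leq_trans cardW le_Bm.
  by move=> i /negPf ->.
rewrite !big_split /=.
have one (j : 'I_P) : (\sum_(i < P) (i == j) = 1)%N.
  by rewrite (bigD1 j) //= eqxx big1 // => i /negPf ->.
by rewrite !one !mulnDr !muln1 !leq_add.
Qed.

(** * The three regimes *)

Lemma sum_card_disjoint (I T : finType) (A : I -> {set T}) (B : {set T}) :
  (forall i j, i != j -> [disjoint A i & A j]) -> (forall i, A i \subset B) ->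
  (\sum_i #|A i| <= #|B|)%N.
Proof.
move=> dis sub; under eq_bigr do rewrite -sum1_card.
rewrite -partition_disjoint_bigcup // sum1_card subset_leq_card //.
by apply/bigcupsP => i _.
Qed.

Lemma leq_sum_seq_in (T : eqType) (r : seq T) (E1 E2 : T -> nat) :
  (forall x, x \in r -> E1 x <= E2 x)%N ->
  (\sum_(x <- r) E1 x <= \sum_(x <- r) E2 x)%N.
Proof. by move=> le12; rewrite !big_seq; apply: leq_sum. Qed.

(** The top eighth of the positions: for such a [t], fewer than [mu / 8] positions lie above [t], so
    the product digit [t] involves most digits of each operand. *)
Definition high (mu : nat) : {set 'I_mu} := [set t : 'I_mu | (7 * mu < 8 * t.+1)%N].

Lemma card_high mu : (mu <= 8 * #|high mu|)%N.
Proof.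
have cardT := cardsC (high mu); rewrite card_ord in cardT.
suff : (#|~: high mu| <= 7 * mu %/ 8)%N by move: cardT; move: #|_| #|_| => *; lia.
have lt8 (t : {t : 'I_mu | t \in ~: high mu}) : ((val t : 'I_mu) < 7 * mu %/ 8)%N.
  by case: t => t /=; rewrite !inE; lia.
have <- : #|{: {t : 'I_mu | t \in ~: high mu}}| = #|~: high mu|.
  by rewrite card_sig; apply: eq_card.
rewrite -[X in (_ <= X)%N]card_ord.
apply: (@leq_card _ _ (fun t => Ordinal (lt8 t))) => t t' /(congr1 val) /=.
by move=> eq_t; apply/val_inj/val_inj.
Qed.

Section Regimes.
Variables (s k : nat) (x : 'I_(npoints k) -> int) (n0 : nat).
Variables (sz : nat -> 'I_(npoints k) -> nat) (n : nat) (G : cdag n).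
Hypotheses (hs : (2 <= s)%N) (k_gt1 : (1 < k)%N) (inj_x : injective x).
Hypothesis wfG : well_formed s G.
Hypothesis sz_bound : forall m i,
  (ceil_div m k <= sz m i <= ceil_div m k + excess s k (x i))%N.
Hypothesis hybridG : hybrid s k x n0 sz G (@inA n G) (@inB n G) (@outC n G) (~: inputs G).

Local Notation at_ := (problem_at s x n0 sz).

Lemma inputs_sources v : v \in inputs G -> preds v = [::].
Proof. by case: wfG => _ _ _ + _ _; apply. Qed.

Lemma problem_sound mu (N : problem G) : at_ mu N ->
  sound s (@opA n G N) (@opB n G N) (@prodC n G N) (psteps N).
Proof. by case=> hyb _ _ _ _; apply: (hybrid_sound k_gt1 inj_x hyb). Qed.

Lemma problem_output mu (N : problem G) (val : G -> int) (alpha : nat -> int) j :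
  at_ mu N -> run s val -> (forall i, 0 <= alpha i < s%:Z) ->
  (forall i, (mu <= i)%N -> alpha i = 0) -> (j < mu)%N ->
  ((forall i, val (inA G i) = alpha i) /\ (forall i, val (inB G i) = unit_digit j i)) \/
  ((forall i, val (inB G i) = alpha i) /\ (forall i, val (inA G i) = unit_digit j i)) ->
  forall t, val (prodC (p := N) t) = if (j <= t)%N then alpha (t - j)%N else 0.
Proof.
move=> atN hrun ha alpha0 lt_j hin.
have [_ _ /(_ val hrun) hC] := problem_sound atN.
have /andP[le_mu _] := at_size atN.
have unit0 i : (mu <= i)%N -> unit_digit j i = 0.
  by rewrite /unit_digit => le_i; case: eqP => // eq_i; lia.
have eq_value m (d e : 'I_m -> int) : d =1 e -> value s d = value s e.
  by move=> eq_de; apply: eq_bigr => i _; rewrite eq_de.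
apply: (shifted_digits (mu := mu) ha alpha0); first by rewrite lt_j.
case: hin => [[inAE inBE]|[inBE inAE]].
  have opAE := op_val (at_opA atN) hrun ha alpha0 inAE.
  have opBE := op_val (at_opB atN) hrun (fun i => unit_digitP j i hs) unit0 inBE.
  by rewrite -(eq_value _ _ _ opAE) -(eq_value _ _ _ opBE).
have opAE := op_val (at_opA atN) hrun (fun i => unit_digitP j i hs) unit0 inAE.
have opBE := op_val (at_opB atN) hrun ha alpha0 inBE.
by rewrite mulrC -(eq_value _ _ _ opAE) -(eq_value _ _ _ opBE).
Qed.

Lemma leq_double_size mu (N : problem G) : at_ mu N -> (mu <= 2 * psize N)%N.
Proof. by move/at_size; lia. Qed.

Lemma supported_above mu (F : {set 'I_mu}) alpha i :
  supported s F alpha -> (mu <= i)%N -> alpha i = 0.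
Proof.
move=> [_ supp] le_i; apply/eqP; apply: contraLR le_i => /supp[j _ ->].
by rewrite -ltnNge.
Qed.

(** All [mu] low digits of A are free here, and [Q] consists of the known words on the side of A, at
    most [3 * M] of them; [96 = 32 * 3] makes [Q] small enough for [output_rate]. *)
Lemma problem_rate mu (N : problem G) (hN : at_ mu N) M (K E : {set G}) :
  (96 * M <= mu)%N -> (#|K| <= 3 * M)%N -> segment_ok K E ->
  (#|[set t in high mu | prodC (widen_ord (leq_double_size hN) t) \in E]|
     <= 64 * #|K :&: psteps N|)%N.
Proof.
move=> le_mu cardK ok; have [cU depU _] := problem_sound hN.
have [hyb le_size sub_U [clA inpA opA_in valA] [clB inpB opB_in valB]] := hN.
apply: (@output_rate s n G hs wfG (@inA n G) (@inB n G) (sideA N) (sideB N)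
  (psteps N) K E (K :&: sideA N) mu setT _
  (fun t => prodC (widen_ord (leq_double_size hN) t))) => //.
- by move=> alpha beta ha hb; apply: (run_exists wfG).
- move=> v vU u /(depU v vU); rewrite !inE.
  by case/or3P=> [->|/codomP[i ->]|/codomP[i ->]]; rewrite ?opA_in ?opB_in ?orbT.
- move=> val alpha j hrun supp inAE inBE t.
  rewrite (problem_output hN hrun (alpha := alpha) (j := j)) //.
  + by case: supp.
  + by move=> i; exact: (supported_above supp).
  by left.
- by move=> t; rewrite inE => /andP[].
- by move=> t; rewrite !inE => /andP[].
- by rewrite cardsT card_ord; lia.
- exact: subsetIr.
by have := subset_leq_card (subsetIl K (sideA N)); lia.
Qed.

(** * Bounds from the segments of an execution: Toom levels and standard algorithms *)

Section Segments.
Variables (M w : nat) (gs : seq (segment G)).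
Hypothesis gs_ok : forall g, g \in gs -> segment_ok (known g) (computed g).
Hypothesis gs_known : forall g, g \in gs -> (#|known g| <= 3 * M)%N.
Hypothesis gs_all : forall v, v \notin inputs G ->
  exists2 g, g \in gs & v \in computed g.
Hypothesis gs_path : forall g v p, g \in gs -> v \in computed g -> dag_path v p ->
  {subset v :: p <= computed g} \/ covered_from gs v p.
Hypothesis gs_cost : (\sum_(g <- gs) cost g <= 3 * w)%N.

(** Each high output digit of each sub-problem is computed in some segment. In a segment,
    [problem_rate] is summed over the sub-problems, whose interiors are disjoint. The constant is
    [8 * 64 * 3], for the fraction of high digits, the rate and the cost. *)
Lemma toom_regime l : (96 * M <= level k n l)%N ->
  (forall i, (i < l)%N -> (n0 < level k n i)%N) ->
  (npoints k ^ l * level k n l <= 1536 * w)%N.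
Proof.
move=> le_level lt_n0.
have root := root_problem wfG hybridG.
have [I [F [cardI disF atF]]] := toom_level k_gt1 sz_bound root lt_n0.
set mu' := level k n l in le_level atF *.
pose c i t := prodC (widen_ord (leq_double_size (atF i)) t).
have stepsF i : psteps (F i) \subset ~: inputs G by case: (atF i).
have cI i t : c i t \notin inputs G.
  have [cU _ _] := problem_sound (atF i).
  by have := subsetP (stepsF i) _ (cU (widen_ord (leq_double_size (atF i)) t)); rewrite in_setC.
have lower : (#|I| * #|high mu'| <=
    \sum_(g <- gs) \sum_i #|[set t in high mu' | c i t \in computed g]|)%N.
  rewrite -sum_nat_const exchange_big /=; apply: leq_sum => i _.
  rewrite -sum1_card.
  have -> : (\sum_(g <- gs) #|[set t in high mu' | c i t \in computed g]|
      = \sum_(g <- gs) \sum_(t in high mu') (c i t \in computed g))%N.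
    apply: eq_bigr => g _; rewrite -sum1_card [LHS]big_mkcond [RHS]big_mkcond.
    by apply: eq_bigr => t _; rewrite inE; case: (t \in high mu') => //=; case: (_ \in _).
  rewrite exchange_big /=; apply: leq_sum => t _.
  by have [g g_in c_in] := gs_all (cI i t); rewrite (big_rem g) //= c_in.
have upper : (\sum_(g <- gs) \sum_i #|[set t in high mu' | c i t \in computed g]|
    <= \sum_(g <- gs) 64 * cost g)%N.
  apply: leq_sum_seq_in => g g_in.
  apply: leq_trans (_ : \sum_i 64 * #|known g :&: psteps (F i)| <= _)%N.
    by apply: leq_sum => i _; apply: problem_rate le_level (gs_known g_in) (gs_ok g_in).
  rewrite -big_distrr leq_mul2l /=; apply: leq_trans (leq_addr _ _).
  apply: sum_card_disjoint => [i j neq|i].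
    by apply: disjointW (disF i j neq); apply: subsetIr.
  by rewrite setDE setIS.
rewrite -big_distrr /= in upper.
rewrite -cardI; have := card_high mu'; move: lower upper gs_cost.
move: #|I| #|high mu'| (\sum_(_ <- _) _)%N (\sum_(_ <- _) _)%N => *; nia.
Qed.


(** The digits of the operand at these positions can be chosen freely through A, and the words of
    [K] on its side determine them; [digit_count] concludes. *)
Lemma known_operands mu m (d : 'I_m -> G) (X : {set G}) (h : (mu <= m)%N) (K E : {set G}) :
  (mu <= n)%N -> operand_of s (@inA n G) mu d X -> segment_ok K E ->
  (#|[set i : 'I_mu | d (widen_ord h i) \in K :|: E]| <= 2 * #|K|)%N.
Proof.
move=> le_n [clX inpX dX valX] ok; set S := [set i | _].
have choose (f : {ffun {i | i \in S} -> 'I_s}) : exists val : G -> int,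
    [/\ run s val, forall i, val (inA G i) = extend f i
      & forall i, val (inB G i) = 0].
  apply: (run_exists wfG (beta := fun=> 0)) => i; first exact: extend_digit.
  by lia.
have [V hV] := fin_all_exists choose.
have extend0 f i : (mu <= i)%N -> extend (S := S) (s := s) f i = 0.
  move=> le_i; apply/eqP; apply: contraLR le_i => /extend_support[j _ ->].
  by rewrite -ltnNge.
have -> : #|K| = #|{: {v | v \in K}}| by rewrite card_sig; apply: eq_card.
have -> : #|S| = #|{: {i | i \in S}}| by rewrite card_sig; apply: eq_card.
apply: (digit_count (e := fun f v => if val v \in X then V f (val v) else 0)) => //.
  move=> f v; case: ifP => _; last by rewrite normr0; lia.
  by have [_ _ _ _ _ word] := wfG; have [/word] := hV f.
move=> f f' eq_e; apply/ffunP => u; apply/val_inj.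
have [run1 inA1 _] := hV f; have [run2 inA2 _] := hV f'.
have agX : {in K :&: X, V f =1 V f'}.
  move=> v; rewrite inE => /andP[vK vX]; have := eq_e (exist _ v vK).
  by rewrite /= vX.
have ag := agree_closed wfG run1 run2 ok clX agX.
have := ag (d (widen_ord h (val u))).
have := valP u; rewrite inE => uKE; rewrite inE uKE dX => /(_ isT).
rewrite (valX _ _ run1 (extend_digit hs f) (extend0 f) inA1).
rewrite (valX _ _ run2 (extend_digit hs f') (extend0 f') inA2).
by rewrite /= !extendE => -[].
Qed.

Lemma leaf_path (T : sumtree G) v : summation s T -> v \in leaves T ->
  exists p, [/\ path (fun u t => t \in preds u) (root_of T) p,
    last (root_of T) p = v & {subset root_of T :: p <= v :: internals T}].
Proof.
elim: T => [u|u l IHl r IHr] /=.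
  by move=> _; rewrite inE => /eqP ->; exists [::]; split.
case=> preds_u _ hl hr; rewrite mem_cat => /orP[/(IHl hl)|/(IHr hr)] [p [pathp lastp sub]].
  exists (root_of l :: p); rewrite /= preds_u mem_head pathp; split=> // t.
  rewrite inE => /orP[/eqP ->|/sub]; first by rewrite !inE eqxx orbT.
  by rewrite !inE mem_cat => /orP[] ->; rewrite ?orbT.
exists (root_of r :: p); rewrite /= preds_u !inE eqxx orbT pathp; split=> // t.
rewrite inE => /orP[/eqP ->|/sub]; first by rewrite !inE eqxx orbT.
by rewrite !inE mem_cat => /orP[] ->; rewrite ?orbT.
Qed.

Lemma standard_problem_cost mu m (a b : 'I_m -> G) (c : 'I_(2 * m) -> G)
    (U X : {set G}) :
  (96 * M <= mu <= m)%N -> (mu <= n)%N -> standard s a b c U ->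
  U \subset ~: inputs G -> operand_of s (@inA n G) mu a X ->
  (mu ^ 2 <= 256 * M * \sum_(g <- gs) #|kept g :&: U|)%N.
Proof.
move=> /andP[le_mu le_m] le_n std sub_U opA_in.
have [cU _ _] := standard_sound std.
case: std => prod [T [carry [K [h_prod [inj_prod [h_T [h_leaves [_ [dis_T [_ [_ [defU _]]]]]]]]]]]].
have h2 : (mu <= 2 * m)%N by lia.
pose w2 (t : 'I_mu) : 'I_(2 * m) := widen_ord h2 t.
pose w1 (i : 'I_mu) : 'I_m := widen_ord le_m i.
pose prods (t : 'I_mu) : {set G} :=
  [set v | [exists ij : 'I_m * 'I_m, (ij.1 + ij.2 == t)%N && (v == prod ij.1 ij.2)]].
pose ints (t : 'I_mu) : {set G} := [set v in internals (T (w2 t))].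
(* A path from the digit [t] down to a product may be cut at the product itself, so kept products
   are counted too. As they may also be counted among the internal vertices, the total over [t] is
   bounded by twice the kept vertices of [U]. *)
pose touched g t := (#|kept g :&: ints t| + #|kept g :&: prods t|)%N.
pose ops g := [set i : 'I_mu | a (w1 i) \in known g :|: computed g].
have prodU i j : prod i j \in U.
  by rewrite defU !inE (codom_f (fun ij => prod ij.1 ij.2) (i, j)).
have UI v : v \in U -> v \notin inputs G by move/(subsetP sub_U); rewrite in_setC.
have ops_le g : g \in gs -> (#|ops g| <= 6 * M)%N.
  move=> g_in; have := known_operands le_m le_n opA_in (gs_ok g_in).
  by have := gs_known g_in; rewrite -/(ops g); lia.
have sub_ints t : ints t \subset U.
  apply/subsetP=> v; rewrite inE => v_in; rewrite defU !inE.
  apply/orP; left; apply/orP; right; apply/bigcupP; exists (w2 t) => //.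
  by rewrite inE.
have sub_prods t : prods t \subset U.
  by apply/subsetP=> v; rewrite inE => /existsP[ij /andP[_ /eqP ->]].
have dis_ints t t' : t != t' -> [disjoint ints t & ints t'].
  move=> neq; rewrite -setI_eq0; apply/eqP/setP => v; rewrite !inE.
  apply/negP => /andP[v_t v_t']; case/eqP: neq.
  apply/val_inj; exact: (congr1 val (dis_T _ _ v v_t v_t')).
have dis_prods t t' : t != t' -> [disjoint prods t & prods t'].
  move=> neq; rewrite -setI_eq0; apply/eqP/setP => v; rewrite !inE.
  apply/negP => /andP[/existsP[ij /andP[/eqP ij_t /eqP ->]]].
  case/existsP=> ij' /andP[/eqP ij_t' /eqP eq_p]; case/eqP: neq; apply: val_inj.
  by rewrite /= -ij_t -ij_t' (inj_prod ij ij' eq_p).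
have touched_le g : (\sum_t touched g t <= 2 * #|kept g :&: U|)%N.
  rewrite big_split mul2n -addnn leq_add //=; apply: sum_card_disjoint => [t t' neq|t].
  - by apply: disjointW (dis_ints t t' neq); apply: subsetIr.
  - exact: setIS.
  - by apply: disjointW (dis_prods t t' neq); apply: subsetIr.
  exact: setIS.
(* The [t + 1] products entering the sum of the digit [t] are computed either
   along with that digit or along with a kept vertex of its tree. *)
have digit (t : 'I_mu) : (t.+1 <= 6 * M * (1 + \sum_(g <- gs) touched g t))%N.
  have [root_t sum_t] := h_T (w2 t).
  have [g0 g0_in c_g0] := gs_all (UI _ (cU (w2 t))).
  have each (i : 'I_mu) : (i <= t)%N ->
      (1 <= (i \in ops g0) + \sum_(g <- gs) (i \in ops g) * touched g t)%N.
    move=> le_it; have lt_j : (t - i < mu)%N by have := ltn_ord t; lia.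
    pose j := Ordinal lt_j; pose v := prod (w1 i) (w1 j).
    have v_leaf : v \in leaves (T (w2 t)).
      rewrite (perm_mem (h_leaves _)) mem_cat; apply/orP; left.
      apply/mapP; exists (w1 i, w1 j) => //.
      by rewrite mem_filter mem_enum /= subnKC ?eqxx.
    have [p [pathp lastp subp]] := leaf_path sum_t v_leaf.
    have dag : dag_path (c (w2 t)) p.
      by rewrite /dag_path -root_t pathp lastp UI // prodU.
    have op_i g : g \in gs -> v \in computed g -> i \in ops g.
      move=> g_in v_g; rewrite inE; have [_] := gs_ok g_in v_g; apply.
      by have [-> _] := h_prod (w1 i) (w1 j); rewrite mem_head.
    have [sub|[g g_in [u [p1 [p2 [def_p sub u_kept]]]]]] := gs_path g0_in c_g0 dag.
      by rewrite op_i // -lastp root_t sub // mem_last.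
    (* The part of the path computed in [g] ends at the product [v], so [g] holds the operand digit
       [i]. *)
    have v_g : v \in computed g.
      apply: sub; rewrite -lastp root_t -[last _ p]/(last (c (w2 t)) (c (w2 t) :: p)).
      by rewrite def_p last_cat /= mem_last.
    have : u \in v :: internals (T (w2 t)).
      by apply: subp; rewrite root_t def_p mem_cat mem_head orbT.
    have touched_gt0 : u \in ints t :|: prods t -> (0 < touched g t)%N.
      rewrite inE addn_gt0 => /orP[u_t|u_t]; apply/orP; [left | right];
        by apply/card_gt0P; exists u; rewrite inE u_kept.
    rewrite (big_rem g) //= (op_i g g_in v_g) mul1n inE => u_in.
    suff gt0 : (0 < touched g t)%N by rewrite addnCA ltn_addr.
    apply: touched_gt0; rewrite !inE; case/orP: u_in => [/eqP ->|->//].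
    apply/orP; right; apply/existsP; exists (w1 i, w1 j) => /=.
    by rewrite subnKC // !eqxx.
  have -> : t.+1 = (\sum_(i < mu | (i < t.+1)%N) 1)%N.
    by rewrite -(big_ord_widen mu (fun=> 1%N)) // sum_nat_const card_ord muln1.
  apply: leq_trans (_ : \sum_(i < mu) ((i \in ops g0)
      + \sum_(g <- gs) (i \in ops g) * touched g t) <= _)%N.
    by rewrite big_mkcond; apply: leq_sum => i _; case: ifP => // /each.
  have card_ops g : (\sum_i (i \in ops g) = #|ops g|)%N.
    by rewrite -sum1_card [RHS]big_mkcond; apply: eq_bigr => i _; case: (i \in ops g).
  rewrite big_split /= card_ops mulnDr muln1 leq_add ?ops_le // exchange_big big_distrr /=.
  apply: leq_sum_seq_in => g g_in.
  by rewrite -big_distrl card_ops leq_mul2r ops_le ?orbT.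
(* A high digit has [t.+1 > 7 * mu / 8], of which the segment computing it accounts for at most
   [6 * M <= mu / 16]; at least [13 * mu / 16] is left for the touched trees. *)
have high_digit t : t \in high mu ->
    (13 * mu <= 96 * M * \sum_(g <- gs) touched g t)%N.
  rewrite inE; have := digit t; move: le_mu (ltn_ord t).
  by move: (\sum_(_ <- _) _)%N => S; nia.
have total : (\sum_(t in high mu) 13 * mu <= 96 * M * \sum_(g <- gs) (2 * #|kept g :&: U|))%N.
  apply: leq_trans (_ : \sum_t 96 * M * \sum_(g <- gs) touched g t <= _)%N.
    by rewrite big_mkcond; apply: leq_sum => t _; case: ifP => // /high_digit.
  rewrite -big_distrr leq_mul2l exchange_big /=; apply/orP; right.
  by apply: leq_sum.
rewrite sum_nat_const -big_distrr /= in total.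
have := card_high mu; move: total; rewrite expnS expn1.
(* With [mu <= 8 * #|high mu|] the constant obtained is [8 * 96 * 2 / 13], below 256. *)
move: #|high mu| (\sum_(_ <- _) _)%N => h S; nia.
Qed.

(** Because of the padding, a problem with [mu <= n0] may still be larger than [n0] and undergo a
    Toom step. Its children then have size at most [(mu + 1) / 2 + slack s x <= n0], so they are
    standard; following one of them loses only a constant factor. *)
Lemma standard_below mu (N : problem G) : at_ mu N -> (mu <= n0)%N ->
  (2 * (slack s x).+1 <= n0)%N -> exists N' : problem G,
  [/\ standard s (@opA n G N') (@opB n G N') (@prodC n G N') (psteps N'),
      psteps N' \subset psteps N, (ceil_div mu k <= psize N')%N
    & operand_of s (@inA n G) (ceil_div mu k) (@opA n G N') (sideA N')].
Proof.
move=> atN le_n0 n0_large.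
have le_mu' := ceil_div_le mu k_gt1.
have [hyb /andP[le_size _] _ opA_in _] := atN.
case: (hybrid_inv hyb) => [[_ std]|[lt_n0 _]].
  exists N; split=> //; first exact: leq_trans le_size.
  exact: operand_of_le opA_in.
have [f [atf sub_f _]] := toom_children k_gt1 sz_bound atN lt_n0.
have np_gt0 : (0 < npoints k)%N by rewrite /npoints; lia.
have [hyb' /andP[le_size' size'_le] _ opA_in' _] := atf (Ordinal np_gt0).
exists (f (Ordinal np_gt0)); split=> //.
case: (hybrid_inv hyb') => [[] //|[lt_n0' _]].
have : (2 * ceil_div mu k <= mu + 1)%N.
  by have [_] := @ceil_divP mu k (ltnW k_gt1); nia.
lia.
Qed.

Lemma standard_regime l : (96 * M <= level k n l.+1)%N ->
  (forall i, (i < l)%N -> (n0 < level k n i)%N) -> (level k n l <= n0)%N ->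
  (2 * (slack s x).+1 <= n0)%N ->
  (npoints k ^ l * level k n l.+1 ^ 2 <= 768 * M * w)%N.
Proof.
move=> le_level lt_n0 le_n0 n0_large.
have root := root_problem wfG hybridG.
have [I [F [cardI disF atF]]] := toom_level k_gt1 sz_bound root lt_n0.
have below i := standard_below (atF i) le_n0 n0_large.
have [F' hF'] := fin_all_exists below.
have level_le j : (level k n j <= n)%N.
  by elim: j => // j IHj; apply: leq_trans IHj; apply: ceil_div_le.
have one i : (level k n l.+1 ^ 2 <= 256 * M * \sum_(g <- gs) #|kept g :&: psteps (F' i)|)%N.
  have [std sub le_size opA_in] := hF' i.
  apply: standard_problem_cost std _ opA_in; first by rewrite le_level.
    exact: (level_le l.+1).
  by apply: subset_trans sub _; case: (atF i).
have : (\sum_(i : I) level k n l.+1 ^ 2 <= 256 * M * \sum_(g <- gs) cost g)%N.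
  apply: leq_trans (leq_sum _ (fun i _ => one i)) _.
  rewrite -big_distrr leq_mul2l exchange_big /=; apply/orP; right.
  apply: leq_sum => g _; apply: leq_trans (leq_addl _ _).
  apply: sum_card_disjoint => [i j neq|i]; last exact: subsetIl.
  have [_ subi _ _] := hF' i; have [_ subj _ _] := hF' j.
  apply: disjointW (disF i j neq); apply: subset_trans (subsetIr _ _) _ => //.
rewrite sum_nat_const cardI => /leq_trans; apply.
by rewrite -[X in (_ <= X)%N]mulnA mulnCA -[768%N]/(256 * 3)%N; nia.
Qed.

End Segments.

(** * Large memory: one segment for each processor, with the roles of A and B interchangeable *)

Section WholeProduct.
Variables (inX inY : 'I_n -> G).
Hypothesis exists_run : forall alpha beta : nat -> int,
  (forall i, 0 <= alpha i < s%:Z) -> (forall i, 0 <= beta i < s%:Z) ->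
  exists val : G -> int, [/\ run s val,
    forall i, val (inX i) = alpha i & forall i, val (inY i) = beta i].
Hypothesis output : forall (val : G -> int) alpha (j : 'I_n), run s val ->
  supported s [set: 'I_n] alpha -> (forall i, val (inX i) = alpha i) ->
  (forall i, val (inY i) = unit_digit j i) ->
  forall t : 'I_(2 * n), val (outC G t) = if (j <= t)%N then alpha (t - j)%N else 0.
Hypothesis injX : injective inX.
Hypothesis inputsE : inputs G = [set v in codom inX] :|: [set v in codom inY].

(** The free digits are those unknown to the segment, and the known ones are set to 0, so [Q] can be
    empty. At most [n / 2 + n / 8] digits are known when few words are received, which leaves
    [3 * n / 8]. *)
Lemma whole_rate (h : (n <= 2 * n)%N) (K L E : {set G}) : segment_ok K E ->
  L \subset inputs G -> L \subset K -> (2 * #|L :&: [set v in codom inX]| <= n)%N ->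
  (#|[set t in high n | outC G (widen_ord h t) \in E]| <= 64 * #|K :\: L|)%N.
Proof.
move=> ok L_in LK fewX; set Z := [set t in _ | _].
(* If more than [n / 8] words were received, the trivial bound [#|Z| <= n] suffices. *)
have [lt_n|le_n] := ltnP n (8 * #|K :\: L|).
  have : (#|Z| <= n)%N by rewrite -[X in (_ <= X)%N]card_ord max_card.
  by lia.
pose F : {set 'I_n} := [set i | inX i \notin K].
have cardF : (3 * n <= 8 * #|F|)%N.
  have := cardsC F; rewrite card_ord.
  have : (#|~: F| <= #|L :&: [set v in codom inX]| + #|K :\: L|)%N.
    rewrite -(card_imset _ injX).
    apply: leq_trans (leq_of_leqif (leq_card_setU _ _)); apply: subset_leq_card.
    apply/subsetP=> v /imsetP[i]; rewrite !inE negbK => iK ->.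
    by rewrite codom_f iK !andbT; case: (_ \in L).
  move: fewX le_n; move: #|_| #|_| #|_| #|_| => *; lia.
have XI v : v \in codom inX -> v \in inputs G by rewrite inputsE !inE => ->.
have YI v : v \in codom inY -> v \in inputs G by rewrite inputsE !inE => ->; rewrite orbT.
apply: leq_trans (_ : 64 * #|K :&: ~: inputs G| <= _)%N; last first.
  by rewrite leq_mul2l subset_leq_card // -setDE setDS.
have [cU _ _] := problem_sound (root_problem wfG hybridG).
apply: (@output_rate s n G hs wfG inX inY [set v in codom inX] [set v in codom inY]
  (~: inputs G) K E set0 n F Z (fun t => outC G (widen_ord h t))) => //.
- by move=> v; rewrite inE => /XI/inputs_sources ->.
- by move=> v; rewrite inE => /YI/inputs_sources ->.
- by move=> v vU u hu; rewrite -inputsE setUC setUCr inE.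
- by move=> v; rewrite inE.
- by move=> v; rewrite inE.
- move=> val alpha j hrun [ha supp] inXE inYE t.
  rewrite (output hrun (alpha := alpha) (j := j)) //.
  by split=> // i /supp[i' _ ->]; exists i'; rewrite ?inE.
- by move=> t; exact: (cU (widen_ord h t)).
- by move=> t; rewrite inE => /andP[].
- by move=> t; rewrite !inE => /andP[].
- exact: sub0set.
- by rewrite cards0.
move=> val val' alpha alpha' _ _ [_ supp] [_ supp'] inXE inXE' _ v.
rewrite !inE => /andP[vK /codomP[i def_v]].
have zero a : (forall i : nat, a i != 0 -> exists2 j : 'I_n, j \in F & i = j) -> a i = 0 :> int.
  move=> suppa; apply/eqP/negP => /negP/suppa[j jF /val_inj eq_ij].
  by move: jF; rewrite inE -eq_ij -def_v vK.
by rewrite def_v inXE inXE' !zero.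
Qed.

End WholeProduct.

(** A processor starts with at most [n] of the [2 * n] input digits, hence with at most half of A or
    at most half of B, and [whole_rate] applies to that operand. The constant is [8 * 64]. *)
Lemma input_regime P M (L0 L : 'I_P -> {set G}) S D w :
  (forall p, L0 p \subset inputs G) -> (forall p, #|L0 p| <= n)%N ->
  machine M L0 L S D w -> complete D -> (n <= 512 * w)%N.
Proof.
move=> L0_in L0_small hm complD.
have [K [E [ok _ cov init words]]] := machine_single hm.
have [injA injB disAB _ _ _] := wfG.
have root := root_problem wfG hybridG.
have h := leq_double_size root; rewrite /= in h.
have alpha0 alpha : supported s [set: 'I_n] alpha -> forall i, (n <= i)%N -> alpha i = 0.
  by move=> supp i; apply: (supported_above supp).
have rate p : (#|[set t in high n | outC G (widen_ord h t) \in E p]| <= 64 * #|K p :\: L0 p|)%N.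
  have : (#|L0 p :&: [set v in codom (@inA n G)]| + #|L0 p :&: [set v in codom (@inB n G)]| <= n)%N.
    rewrite -cardsUI -setIUr (setIidPl (L0_in p)) setIACA setIid.
    rewrite (_ : [set v in codom (@inA n G)] :&: _ = set0) ?setI0 ?cards0 ?addn0 ?L0_small //.
    apply/setP=> v; rewrite !inE; apply/negP => /andP[/codomP[i ->] /codomP[j eq_ij]].
    by case/eqP: (disAB i j).
  have [fewA _|manyA fewB] := leqP (2 * #|L0 p :&: [set v in codom (@inA n G)]|) n.
    apply: (@whole_rate (@inA n G) (@inB n G)) => //.
    - by move=> alpha beta; apply: run_exists.
    - move=> val alpha j hrun supp inAE inBE t.
      rewrite (problem_output root hrun (alpha := alpha) (j := j)) //.
      + by case: supp.
      + exact: alpha0.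
      by left.
  apply: (@whole_rate (@inB n G) (@inA n G)) => //.
  - move=> alpha beta ha hb; have [val [hrun valA valB]] := run_exists wfG hb ha.
    by exists val.
  - move=> val alpha j hrun supp inBE inAE t.
    rewrite (problem_output root hrun (alpha := alpha) (j := j)) //.
    + by case: supp.
    + exact: alpha0.
    by right.
  - by rewrite setUC.
  by lia.
have [cU _ _] := problem_sound root; rewrite /= in cU.
have lower : (#|high n| <= \sum_p #|[set t in high n | outC G (widen_ord h t) \in E p]|)%N.
  have -> : (\sum_p #|[set t in high n | outC G (widen_ord h t) \in E p]|
      = \sum_p \sum_(t in high n) (outC G (widen_ord h t) \in E p))%N.
    apply: eq_bigr => p _; rewrite -sum1_card [LHS]big_mkcond [RHS]big_mkcond.
    by apply: eq_bigr => t _; rewrite inE; case: (t \in high n) => //=; case: (_ \in _).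
  rewrite exchange_big -sum1_card; apply: leq_sum => t _.
  have [p c_p] := cov _ (subsetP complD _ (cU (widen_ord h t))).
  by rewrite (bigD1 p) //= c_p.
have upper : (\sum_p #|[set t in high n | outC G (widen_ord h t) \in E p]| <= 64 * w)%N.
  apply: leq_trans (leq_sum _ (fun p _ => rate p)) _.
  by rewrite -big_distrr leq_mul2l words orbT.
by have := card_high n; lia.
Qed.

End Regimes.

(** * The bound over the reals *)

Section Levels.
Variables (k : nat).
Hypothesis k_gt1 : (1 < k)%N.

Lemma level_ge n l : (n <= k ^ l * level k n l)%N.
Proof.
elim: l => [|l IHl]; first by rewrite mul1n.
have [le_level _] := @ceil_divP (level k n l) k (ltnW k_gt1).
by apply: leq_trans IHl _; rewrite expnSr -mulnA leq_mul2l le_level orbT.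
Qed.

Lemma exists_level n y : (0 < y)%N -> (y < n)%N ->
  exists l, (level k n l.+1 <= y)%N /\ forall i, (i <= l)%N -> (y < level k n i)%N.
Proof.
move=> y_gt0 lt_yn.
have ex : exists l, (level k n l <= y)%N.
  (* Because of the rounding, levels decrease to 1 but not to 0; [0 < y] makes this sufficient. *)
  suff bound l : (level k n l <= maxn 1 (n - l))%N.
    by exists n; have := bound n; rewrite subnn; lia.
  elim: l => [|l IHl]; first by rewrite subn0 leq_maxr.
  have : (ceil_div (level k n l) k <= maxn 1 (level k n l).-1)%N.
    have [_] := @ceil_divP (level k n l) k (ltnW k_gt1).
    by nia.
  by move: IHl; rewrite /level iterS -/(level k n l); lia.
case: (ex_minnP ex) => -[|l] le_l min_l; first by move: le_l; rewrite leqNgt lt_yn.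
by exists l; split=> // i le_i; rewrite ltnNge; apply/negP => /min_l; lia.
Qed.

End Levels.

(** * Choice of the regime and of the level *)

Section WordBounds.
Variables (s k : nat) (x : 'I_(npoints k) -> int).
Hypotheses (hs : (2 <= s)%N) (k_gt1 : (1 < k)%N) (inj_x : injective x).

(** When [n0] exceeds [threshold * M], the first term keeps a size of at least [n0 / k ^ 2] above
    [96 * M], and the second lets [standard_below] apply. *)
Definition threshold : nat := (96 * k ^ 2 + 2 * (slack s x).+1)%N.

(** The cases are those of [input_regime], of [toom_regime] at the last level of size above
    [threshold * M], and of [standard_regime] at the first level of size at most [n0]. In the
    second, [16 = 1536 / 96]. *)
Lemma word_bounds n n0 (G : cdag n) P M (L0 L : 'I_P -> {set G}) S D w :
  (0 < n0 <= n)%N -> (0 < M)%N -> UH s k x n0 G ->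
  (forall p, L0 p \subset inputs G) -> (forall p, #|L0 p| <= M)%N ->
  (forall p, #|L0 p| <= n)%N -> machine M L0 L S D w -> complete D ->
  [\/ [/\ (n0 <= threshold * M)%N, (n <= threshold * M)%N & (n <= 512 * w)%N],
      (n0 <= threshold * M)%N /\ exists l,
        (n <= threshold * M * k ^ l.+1)%N /\ (npoints k ^ l * M <= 16 * w)%N
    | (threshold * M < n0)%N /\ exists l,
        (n <= n0 * k ^ l)%N /\ (npoints k ^ l * n0 ^ 2 <= 768 * k ^ 4 * M * w)%N].
Proof.
move=> /andP[n0_gt0 le_n0] M_gt0 [wfG [sz sz_bound hyb]] L0_in L0_M L0_n hm complD.
have src := inputs_sources wfG.
have [gs [gs_ok gs_known gs_all gs_path gs_cost]] :=
  machine_segments L0_in L0_M src M_gt0 hm.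
have all v : v \notin inputs G -> exists2 g, g \in gs & v \in computed g.
  by move=> vI; apply: gs_all; apply: (subsetP complD); rewrite in_setC.
have thr : (96 * M <= threshold * M)%N.
  by rewrite leq_mul2r /threshold; nia.
have [le_n0M|lt_Mn0] := leqP n0 (threshold * M).
  have [le_nM|lt_Mn] := leqP n (threshold * M).
    constructor 1; split=> //.
    exact: (input_regime hs k_gt1 inj_x wfG hyb L0_in L0_n hm complD).
  constructor 2; split=> //.
  have [|l [le_l gt_l]] := exists_level k_gt1 _ lt_Mn; first by nia.
  exists l; split.
    by apply: leq_trans (level_ge k_gt1 n l.+1) _; rewrite mulnC leq_mul2r le_l orbT.
  have := @toom_regime s k x n0 sz n G hs k_gt1 inj_x wfG sz_bound hyb M w gs
    gs_ok gs_known all gs_cost l.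
  have := gt_l l (leqnn l) => lt_l.
  have lt_i i : (i < l)%N -> (n0 < level k n i)%N.
    by move=> lt_i; apply: leq_ltn_trans le_n0M (gt_l i (ltnW lt_i)).
  move=> /(_ (leq_trans thr (ltnW lt_l)) lt_i).
  have := leq_trans thr (ltnW lt_l); nia.
constructor 3; split=> //.
(* The factor [k ^ 2] covers two divisions: the one that brings the size to at most [n0], and the
   further one made by [standard_below]. *)
have [l [le_l gt_l le_lS]] : exists l, [/\ (level k n l <= n0)%N,
    forall i, (i < l)%N -> (n0 < level k n i)%N & (n0 <= k ^ 2 * level k n l.+1)%N].
  have step m : (m <= k * ceil_div m k)%N by have [] := @ceil_divP m k (ltnW k_gt1).
  have [le_n|lt_n] := leqP n n0.
    by exists 0%N; split=> //; have := step n; rewrite /level /=; nia.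
  have [l [le_l gt_l]] := exists_level k_gt1 n0_gt0 lt_n.
  exists l.+1; split=> //; have := gt_l l (leqnn l).
  have := step (level k n l); have := step (level k n l.+1).
  by rewrite /level /= -/(level k n l); nia.
exists l; split.
  by apply: leq_trans (level_ge k_gt1 n l) _; rewrite mulnC leq_mul2r le_l orbT.
have large : (96 * M <= level k n l.+1)%N.
  by move: lt_Mn0; rewrite /threshold; nia.
have := @standard_regime s k x n0 sz n G hs k_gt1 wfG sz_bound hyb M w gs
  gs_ok gs_known all gs_path gs_cost l large gt_l le_l.
have small : (2 * (slack s x).+1 <= n0)%N by move: lt_Mn0; rewrite /threshold; nia.
move=> /(_ small) bound.
have sq : (n0 ^ 2 <= k ^ 4 * level k n l.+1 ^ 2)%N.
  by rewrite (expnM k 2 2) -expnMn leq_exp2r.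
apply: leq_trans (_ : npoints k ^ l * (k ^ 4 * level k n l.+1 ^ 2) <= _)%N.
  by rewrite leq_mul2l sq orbT.
have -> : (768 * k ^ 4 * M * w = k ^ 4 * (768 * M * w))%N by ring.
by rewrite mulnCA leq_mul2l bound orbT.
Qed.

End WordBounds.

(** * Real exponents *)

Section RealBounds.
Variables (R : realType) (k : nat).
Hypothesis k_gt1 : (1 < k)%N.

Local Notation omega := (logb R k (2 * k - 1)).

Lemma lnk_gt0 : 0 < ln k%:R :> R.
Proof. by rewrite ln_gt0 // ltr1n. Qed.

Lemma omega_ge1 : 1 <= omega.
Proof.
have np_gt0 : (0 < 2 * k - 1)%N by lia.
rewrite /logb ler_pdivlMr ?lnk_gt0 // mul1r ler_ln ?posrE ?ltr0n //; last by lia.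
by rewrite ler_nat; lia.
Qed.

Lemma powR_omega l : ((k ^ l)%:R : R) `^ omega = ((npoints k ^ l)%N)%:R.
Proof.
have k_gt0 : 0 < k%:R :> R by rewrite ltr0n; lia.
have np_gt0 : 0 < (2 * k - 1)%N%:R :> R by rewrite ltr0n; lia.
rewrite natrX -powR_mulrn ?ler0n // -powRrM mulrC powRrM powR_mulrn ?powR_ge0 //.
rewrite natrX /npoints -subn1; congr (_ ^+ l).
rewrite /powR gt_eqF // /logb divfK ?gt_eqF ?lnk_gt0 //.
by rewrite lnK ?posrE.
Qed.

Lemma powR_level (n m l c : nat) : (0 < m)%N -> (n <= m * c * k ^ l)%N ->
  (n%:R / m%:R : R) `^ omega <= c%:R `^ omega * ((npoints k ^ l)%N)%:R.
Proof.
move=> m_gt0 le_n; rewrite -powR_omega -powRM ?ler0n //.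
have omega_ge0 : 0 <= omega by apply: le_trans omega_ge1.
apply: ge0_ler_powR => //; rewrite ?nnegrE ?mulr_ge0 ?invr_ge0 ?ler0n //.
by rewrite ler_pdivrMr ?ltr0n // -!natrM ler_nat; nia.
Qed.

End RealBounds.

Section HybridBound.
Variables (R : realType) (s k : nat) (x : 'I_(npoints k) -> int).
Hypotheses (hs : (2 <= s)%N) (k_gt1 : (1 < k)%N) (inj_x : injective x).

Local Notation thr := (threshold s x).
Local Notation omega := (logb R k (2 * k - 1)).

(** One term for each case of [word_bounds]; as all are nonnegative, each case only has to reach its
    own. *)
Definition words_factor : R :=
  512 * thr%:R ^+ 2 * thr%:R `^ (omega - 1)
  + 16 * thr%:R ^+ 2 * (thr * k)%:R `^ omega + 768 * k%:R ^+ 4.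

Lemma words_factor_gt0 : 0 < words_factor.
Proof.
rewrite ltr_wpDl //; last by rewrite mulr_gt0 ?exprn_gt0 ?ltr0n //; lia.
by rewrite addr_ge0 // !mulr_ge0 ?powR_ge0 ?exprn_ge0 ?ler0n.
Qed.

Lemma hybrid_bound_words n n0 (G : cdag n) P M (L0 L : 'I_P -> {set G}) S D w :
  (0 < n0 <= n)%N -> (0 < M)%N -> UH s k x n0 G ->
  (forall p, L0 p \subset inputs G) -> (forall p, #|L0 p| <= M)%N ->
  (forall p, #|L0 p| <= n)%N -> machine M L0 L S D w -> complete D ->
  hybrid_bound R k n n0 M * M%:R <= words_factor * w%:R.
Proof.
move=> n0P M_gt0 uh L0_in L0_M L0_n hm complD.
have [n0_gt0 le_n0] := andP n0P.
have M_gt0' : 0 < M%:R :> R by rewrite ltr0n.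
have thr_gt0 : (0 < thr)%N by rewrite /threshold; lia.
have thr_gt0' : 0 < thr%:R :> R by rewrite ltr0n.
have mx_gt0 : (0 < maxn n0 M)%N by lia.
have mx_gt0' : 0 < (maxn n0 M)%:R :> R by rewrite ltr0n.
set X : R := 512 * thr%:R ^+ 2 * thr%:R `^ (omega - 1).
set Y : R := 16 * thr%:R ^+ 2 * (thr * k)%:R `^ omega.
set Z : R := 768 * k%:R ^+ 4.
have X_ge0 : 0 <= X by rewrite !mulr_ge0 ?powR_ge0 ?exprn_ge0 ?ler0n.
have Y_ge0 : 0 <= Y by rewrite !mulr_ge0 ?powR_ge0 ?exprn_ge0 ?ler0n.
have Z_ge0 : 0 <= Z by rewrite !mulr_ge0 ?exprn_ge0 ?ler0n.
have w_ge0 : 0 <= w%:R :> R by rewrite ler0n.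
have omega1 := omega_ge1 R k_gt1.
rewrite /words_factor -/X -/Y -/Z /hybrid_bound.
set Q : R := _ `^ _; set T : R := _ ^+ 2.
have Q_ge0 : 0 <= Q by apply: powR_ge0.
have T_ge0 : 0 <= T by apply: sqr_ge0.
have T_le : (n0 <= thr * M)%N -> T <= thr%:R ^+ 2.
  move=> le; rewrite ler_pXn2r ?nnegrE ?ler0n ?le_max ?ler01 //.
  rewrite ge_max ler1n thr_gt0 ler_pdivrMr // -natrM ler_nat //.
have [[le_n0M le_nM le_nw]|[le_n0M [l [le_n le_w]]]|[lt_Mn0 [l [le_n le_w]]]] :=
  word_bounds hs k_gt1 inj_x n0P M_gt0 uh L0_in L0_M L0_n hm complD.
- have ratio_gt0 : 0 < n%:R / (maxn n0 M)%:R :> R.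
    by rewrite divr_gt0 // ltr0n (leq_trans n0_gt0).
  (* One factor of the ratio is split off: multiplied by [M] it gives at most [n], which is bounded
     by the words moved. The remaining power has a nonnegative exponent and a base of at most
     [thr]. *)
  have QE : Q = n%:R / (maxn n0 M)%:R * (n%:R / (maxn n0 M)%:R) `^ (omega - 1).
    rewrite /Q -{2}[_ / _]powRr1 ?ltW // -powRD ?(gt_eqF ratio_gt0) ?implybT //.
    by rewrite addrC subrK.
  have rest_le : (n%:R / (maxn n0 M)%:R : R) `^ (omega - 1) <= thr%:R `^ (omega - 1).
    apply: ge0_ler_powR; [by rewrite subr_ge0 | by rewrite nnegrE ltW
      | by rewrite nnegrE ltW |].
    rewrite ler_pdivrMr // -natrM ler_nat; apply: leq_trans le_nM _.
    by rewrite leq_mul2l leq_maxr orbT.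
  have QM_le : Q * M%:R <= n%:R * thr%:R `^ (omega - 1).
    rewrite QE mulrAC; apply: ler_pM => //; first by rewrite mulr_ge0 ?ltW.
      exact: powR_ge0.
    by rewrite mulrAC ler_pdivrMr // -!natrM ler_nat leq_mul2l leq_maxr orbT.
  apply: le_trans (_ : X * w%:R <= _); last by rewrite ler_wpM2r // -addrA lerDl addr_ge0.
  rewrite mulrAC; apply: le_trans (ler_pM _ _ QM_le (T_le le_n0M)) _ => //.
    by rewrite mulr_ge0 // ltW.
  have n_le : n%:R <= 512 * w%:R :> R by rewrite -natrM ler_nat.
  rewrite /X; have := ler_wpM2r (mulr_ge0 (powR_ge0 thr%:R (omega - 1)) (sqr_ge0 thr%:R)) n_le.
  by rewrite !mulrA; congr (_ <= _); ring.
- have le_n' : (n <= maxn n0 M * (thr * k) * k ^ l)%N.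
    apply: leq_trans le_n _; rewrite expnS.
    have -> : (thr * M * (k * k ^ l) = M * (thr * k) * k ^ l)%N by ring.
    by rewrite !leq_mul2r leq_maxr !orbT.
  have Q_le := powR_level R k_gt1 mx_gt0 le_n'; rewrite -/Q in Q_le.
  apply: le_trans (_ : Y * w%:R <= _).
    2: by rewrite ler_wpM2r // addrAC lerDr addr_ge0.
  have N_le : ((npoints k ^ l)%N)%:R * M%:R <= 16 * w%:R :> R.
    by rewrite -!natrM ler_nat.
  have QM_le := ler_wpM2r (ltW M_gt0') Q_le.
  rewrite mulrAC; apply: le_trans (ler_pM _ _ QM_le (T_le le_n0M)) _ => //.
    by rewrite mulr_ge0 // ltW.
  rewrite /Y.
  have := ler_wpM2l (mulr_ge0 (powR_ge0 (thr * k)%:R omega) (sqr_ge0 (thr%:R : R))) N_le.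
  by congr (_ <= _); ring.
(* In the standard case both maxima are attained by the terms in [n0]. *)
have le_Mn0 : (M <= n0)%N by apply: leq_trans (ltnW lt_Mn0); rewrite leq_pmull.
have maxE : maxn n0 M = n0 by apply/maxn_idPl.
have le_n' : (n <= n0 * 1 * k ^ l)%N by rewrite muln1.
have Q_le := powR_level R k_gt1 n0_gt0 le_n'; rewrite powR1 mul1r in Q_le.
apply: le_trans (_ : Z * w%:R <= _); last by rewrite ler_wpM2r // lerDr addr_ge0.
have TE : T = (n0%:R / M%:R) ^+ 2.
  by rewrite /T max_r // ler_pdivlMr // mul1r ler_nat.
rewrite /Q maxE TE; apply: le_trans (_ : ((npoints k ^ l)%N)%:R * (n0%:R / M%:R) ^+ 2 * M%:R <= _).
  by rewrite !ler_wpM2r ?sqr_ge0 // ltW.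
have -> : ((npoints k ^ l)%N)%:R * (n0%:R / M%:R) ^+ 2 * M%:R
    = ((npoints k ^ l * n0 ^ 2)%N)%:R / M%:R :> R.
  by rewrite natrM natrX; field; rewrite gt_eqF.
rewrite ler_pdivrMr // /Z -natrX -!natrM ler_nat.
by apply: leq_trans le_w _; rewrite mulnAC.
Qed.

End HybridBound.

Lemma exists_ge_average (P : nat) (q : 'I_P -> nat) : (0 < P)%N ->
  exists p, (\sum_i q i <= P * q p)%N.
Proof.
move=> P_gt0; case: (@arg_maxnP _ (Ordinal P_gt0) xpredT q isT) => p _ max_p.
exists p; have -> : (P * q p = \sum_(i < P) q p)%N by rewrite sum_nat_const card_ord.
by apply: leq_sum => i _; apply: max_p.
Qed.

Theorem theorem2 (R : realType) (s k : nat) (x : 'I_(npoints k) -> int)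
    (hs : (2 <= s)%N) (hk : (2 <= k)%N) (hx : injective x) :
  (exists2 c : R, 0 < c &
     forall (n n0 M B : nat) (G : cdag n),
       (0 < n0 <= n)%N -> (0 < B <= M)%N -> UH s k x n0 G ->
       forall (C : {set G}) (mem : nat -> option G) (D : {set G}) (q : nat),
         seq_exec M B C mem D q -> complete D ->
         c * (hybrid_bound R k n n0 M * (M%:R / B%:R)) <= q%:R)
  /\
  (exists2 c : R, 0 < c &
     forall (n n0 P M Bm : nat) (G : cdag n),
       (0 < n0 <= n)%N -> (0 < P)%N -> (M < n ^ 2)%N -> (0 < Bm <= M)%N ->
       UH s k x n0 G ->
       forall (L : 'I_P -> {set G}) (D : {set G}) (q : 'I_P -> nat),
         par_exec M Bm L D q -> complete D ->
         exists p : 'I_P,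
           c * (hybrid_bound R k n n0 M * (M%:R / (P%:R * Bm%:R))) <= (q p)%:R).
Proof.
(* Both parts use the same constant, determined by the base and the evaluation points alone. *)
have C_gt0 := words_factor_gt0 R x hs hk.
split; exists (words_factor R s x)^-1; rewrite ?invr_gt0 //.
  move=> n n0 M B G n0P /andP[B_gt0 le_BM] uh C mem D q exec complD.
  have [L [S [w [hm _ _ le_w]]]] := seq_exec_machine le_BM exec.
  have B_gt0' : 0 < B%:R :> R by rewrite ltr0n.
  have bound : hybrid_bound R k n n0 M * M%:R <= words_factor R s x * w%:R.
    apply: (hybrid_bound_words R hs hk hx n0P (leq_trans B_gt0 le_BM) uh _ _ _ hm complD).
    - by move=> _; apply: sub0set.
    - by move=> _; rewrite cards0.
    by move=> _; rewrite cards0.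
  rewrite ler_pdivrMl // mulrA ler_pdivrMr // -mulrA; apply: le_trans bound _.
  by rewrite ler_pM2l // -natrM ler_nat mulnC.
move=> n n0 P M Bm G n0P P_gt0 _ /andP[Bm_gt0 le_BmM] uh L D q exec complD.
have [L0 [S [w [[L0_in _ L0_small] hm le_w]]]] := par_exec_machine le_BmM exec.
have bound : hybrid_bound R k n n0 M * M%:R <= words_factor R s x * w%:R.
  apply: (hybrid_bound_words R hs hk hx n0P _ uh L0_in _ _ hm complD) => [|p|p].
  - exact: leq_trans Bm_gt0 le_BmM.
  - by have [] := L0_small p.
  by have [] := L0_small p.
(* The words are bounded by [Bm] times the total number of messages, and some processor handles at
   least the average number. *)
have [p avg] := exists_ge_average q P_gt0; exists p.
rewrite ler_pdivrMl // mulrA ler_pdivrMr ?mulr_gt0 ?ltr0n // -mulrA.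
apply: le_trans bound _; rewrite ler_pM2l // -!natrM ler_nat.
apply: leq_trans le_w _; apply: leq_trans (leq_mul (leqnn Bm) avg) _.
by rewrite mulnA [(Bm * P)%N]mulnC mulnC.
Qed.
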